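(* Let $n\ge 1$ be an integer and let $\mathscr{M}$ be an $n$-cluster-tilting subcategory of a skeletally small abelian length category $\mathcal{A}$. For an $n$-torsion class $\mathscr{U}$ in $\mathscr{M}$ let $T(\mathscr{U})$ denote the minimal torsion class in $\mathcal{A}$ containing $\mathscr{U}$. Then $\mathscr{U}\mapsto T(\mathscr{U})$ defines an injective morphism of posets (both sides ordered by inclusion) $$T:\{n\text{-torsion classes in }\mathscr{M}\}\to\{\text{torsion classes in }\mathcal{A}\}.$$ Moreover, a torsion class $\mathcal{T}$ in $\mathcal{A}$, with associated torsion functor $t=t_{\mathcal{T}}$, is of the form $T(\mathscr{U})$ for some $n$-torsion class $\mathscr{U}$ in $\mathscr{M}$ if and only if the following three conditions hold: (1) $tM\in\mathscr{M}$ for all $M\in\mathscr{M}$; (2) $\mathcal{T}$ is the minimal torsion class in $\mathcal{A}$ containing $\{tM : M\in\mathscr{M}\}$; (3) $\operatorname{Ext}^{n-1}_{\mathcal{A}}(X,Y)=0$ for all $X\in\{tM : M\in\mathscr{M}\}$ and all $Y\in\{\operatorname{coker}(tM\hookrightarrow M) : M\in\mathscr{M}\}$. In this case, $\mathscr{U}=\mathcal{T}\cap\mathscr{M}=\{tM : M\in\mathscr{M}\}$.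
   Context: Conventions: a length category is an abelian category in which every object has a finite composition series; skeletally small means the isomorphism classes of objects form a set. All subcategories are full and closed under isomorphism; $\{tM : M\in\mathscr{M}\}$ is understood up to isomorphism. $\operatorname{Ext}^0=\operatorname{Hom}$. $n$-cluster-tilting: a functorially finite subcategory $\mathscr{M}$ of $\mathcal{A}$ which is generating (every object of $\mathcal{A}$ is a quotient of an object of $\mathscr{M}$) and cogenerating (every object of $\mathcal{A}$ is a subobject of an object of $\mathscr{M}$) is $n$-cluster-tilting if $\mathscr{M}=\{X\in\mathcal{A}:\operatorname{Ext}^i_{\mathcal{A}}(X,M)=0\ \forall M\in\mathscr{M},\ 1\le i\le n-1\}=\{Y\in\mathcal{A}:\operatorname{Ext}^i_{\mathcal{A}}(M,Y)=0\ \forall M\in\mathscr{M},\ 1\le i\le n-1\}$. $n$-exact sequences: in an additive category $\mathscr{M}$, a sequence $X^1\xrightarrow{f^1}\cdots\xrightarrow{f^n}X^{n+1}$ is an $n$-cokernel of $f^0:X^0\to X^1$ if $0\to\mathscr{M}(X^{n+1},M)\to\cdots\to\mathscr{M}(X^1,M)\to\mathscr{M}(X^0,M)$ is exact for every $M\in\mathscr{M}$; $n$-kernels are defined dually. $X^0\xrightarrow{f^0}\cdots\xrightarrow{f^n}X^{n+1}$ is $n$-exact if $(f^1,\dots,f^n)$ is an $n$-cokernel of $f^0$ and $(f^0,\dots,f^{n-1})$ is an $n$-kernel of $f^n$. $n$-torsion class: a full subcategory $\mathscr{U}\subseteq\mathscr{M}$ such that for every $M\in\mathscr{M}$ there is an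 $n$-exact sequence $0\to U^M\to M\to V^1\to\cdots\to V^n\to 0$ in $\mathscr{M}$ with $U^M\in\mathscr{U}$ and such that $0\to\operatorname{Hom}(U,V^1)\to\operatorname{Hom}(U,V^2)\to\cdots\to\operatorname{Hom}(U,V^n)\to 0$ is exact for all $U\in\mathscr{U}$. Torsion classes: a torsion pair $(\mathcal{T},\mathcal{F})$ in $\mathcal{A}$ is a pair of full subcategories with $\operatorname{Hom}_{\mathcal{A}}(\mathcal{T},\mathcal{F})=0$ such that each $M\in\mathcal{A}$ has a (unique up to isomorphism) short exact sequence $0\to tM\to M\to fM\to 0$ with $tM\in\mathcal{T}$, $fM\in\mathcal{F}$; $\mathcal{T}$ is then called a torsion class and $t=t_{\mathcal{T}}$ its torsion functor. Equivalently, torsion classes are the full subcategories closed under quotients and extensions. *)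

(* Defs.v *)
From Stdlib Require Import Relation_Operators.
From mathcomp Require Import all_boot all_algebra.

Set Implicit Arguments.
Unset Strict Implicit.
Unset Printing Implicit Defensive.

Declare Scope cat_scope.
Delimit Scope cat_scope with cat.
Local Open Scope cat_scope.

Reserved Notation "g ∘ f" (at level 40, left associativity).
Reserved Notation "U ⊆ V" (at level 70, no associativity).
Reserved Notation "U ≡ V" (at level 70, no associativity).

Record preadditive := Preadditive {
  obj :> Type;
  hom : obj -> obj -> zmodType;
  idm : forall X, hom X X;
  comp : forall X Y Z, hom Y Z -> hom X Y -> hom X Z;
  compA : forall W X Y Z (h : hom Y Z) (g : hom X Y) (f : hom W X),
    comp h (comp g f) = comp (comp h g) f;
  comp1m : forall X Y (f : hom X Y), comp (idm Y) f = f;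
  compm1 : forall X Y (f : hom X Y), comp f (idm X) = f;
  compDl : forall X Y Z (g g' : hom Y Z) (f : hom X Y),
    comp (g + g')%R f = (comp g f + comp g' f)%R;
  compDr : forall X Y Z (g : hom Y Z) (f f' : hom X Y),
    comp g (f + f')%R = (comp g f + comp g f')%R
}.

Arguments hom {p} X Y.
Arguments idm {p} X.
Arguments comp {p X Y Z} g f.

Notation "g ∘ f" := (comp g f) : cat_scope.

Section Categories.
Variable C : preadditive.

Definition mono (X Y : C) (f : hom X Y) : Prop :=
  forall W (g h : hom W X), f ∘ g = f ∘ h -> g = h.

Definition epi (X Y : C) (f : hom X Y) : Prop :=
  forall Z (g h : hom Y Z), g ∘ f = h ∘ f -> g = h.

Definition is_iso (X Y : C) (f : hom X Y) : Prop :=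
  exists g : hom Y X, g ∘ f = idm X /\ f ∘ g = idm Y.

Definition isomorphic (X Y : C) : Prop := exists f : hom X Y, is_iso f.

Definition is_zero (Z : C) : Prop :=
  (forall X (f : hom X Z), f = 0%R) /\ (forall X (f : hom Z X), f = 0%R).

Definition is_biproduct (X Y P : C)
    (i : hom X P) (j : hom Y P) (p : hom P X) (q : hom P Y) : Prop :=
  [/\ p ∘ i = idm X, q ∘ j = idm Y, q ∘ i = 0%R, p ∘ j = 0%R
    & (i ∘ p + j ∘ q)%R = idm P].

(* [is_kernel f k]: k is a kernel of f. *)
Definition is_kernel (X Y K : C) (f : hom X Y) (k : hom K X) : Prop :=
  f ∘ k = 0%R /\
  forall W (h : hom W X), f ∘ h = 0%R -> exists! h' : hom W K, k ∘ h' = h.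

Definition is_cokernel (X Y Q : C) (f : hom X Y) (c : hom Y Q) : Prop :=
  c ∘ f = 0%R /\
  forall W (h : hom Y W), h ∘ f = 0%R -> exists! h' : hom Q W, h' ∘ c = h.

Definition is_image (X Y I : C) (f : hom X Y) (m : hom I Y) : Prop :=
  exists (Q : C) (c : hom Y Q), is_cokernel f c /\ is_kernel c m.

Definition exact (X Y Z : C) (f : hom X Y) (g : hom Y Z) : Prop :=
  exists (I : C) (m : hom I Y), is_image f m /\ is_kernel g m.

Definition short_exact (X Y Z : C) (i : hom X Y) (p : hom Y Z) : Prop :=
  is_kernel p i /\ is_cokernel i p.

Definition abelian : Prop :=
  [/\ (exists Z : C, is_zero Z),
      (forall X Y : C, exists (P : C) (i : hom X P) (j : hom Y P)
         (p : hom P X) (q : hom P Y), is_biproduct i j p q),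
      (forall (X Y : C) (f : hom X Y),
         (exists (K : C) (k : hom K X), is_kernel f k) /\
         (exists (Q : C) (c : hom Y Q), is_cokernel f c)),
      (forall (X Y : C) (f : hom X Y), mono f ->
         exists (Z : C) (g : hom Y Z), is_kernel g f)
    & (forall (X Y : C) (f : hom X Y), epi f ->
         exists (W : C) (g : hom W X), is_cokernel g f)].

Definition simple (S : C) : Prop :=
  ~ is_zero S /\
  forall (X : C) (f : hom X S), mono f -> is_zero X \/ is_iso f.

(* A composition series, built one simple quotient at a time. *)
Inductive has_composition_series : C -> Prop :=
| comp_series0 (X : C) : is_zero X -> has_composition_series X
| comp_seriesS (X' X S : C) (i : hom X' X) (p : hom X S) :
    has_composition_series X' -> short_exact i p -> simple S ->
    has_composition_series X.

Definition length_category : Prop := forall X : C, has_composition_series X.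

(* The universe of [choiceType], in which the hom-sets live, plays the role
   of the universe of sets; the universe of the objects is independent. *)
Definition skeletally_small : Prop :=
  exists (S : choiceType) (F : S -> C), forall X, exists s, isomorphic X (F s).

Definition subcat : Type := C -> Prop.

Definition subcat_le (U V : subcat) : Prop := forall X, U X -> V X.
Definition subcat_eq (U V : subcat) : Prop := forall X, U X <-> V X.
Definition subcat_cap (U V : subcat) : subcat := fun X => U X /\ V X.

Definition iso_closed (U : subcat) : Prop :=
  forall X Y, isomorphic X Y -> U X -> U Y.

(* Finite sequences X^0 -> ... -> X^m are encoded by infinite families of
   which only the terms in range are ever constrained. *)
Record sequence := Sequence {
  term :> nat -> C;
  diff : forall i, hom (term i) (term i.+1)
}.

(* An n-extension 0 -> Y -> E_1 -> ... -> E_n -> X -> 0; the outer terms of the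
   sequence are identified with Y and X through isomorphisms. *)
Record extension (n : nat) (X Y : C) := Extension {
  ext_seq :> sequence;
  ext_in : hom Y (ext_seq 0);
  ext_out : hom (ext_seq n.+1) X;
  ext_in_iso : is_iso ext_in;
  ext_out_iso : is_iso ext_out;
  ext_mono : mono (diff ext_seq 0);
  ext_exact : forall i, i < n -> exact (diff ext_seq i) (diff ext_seq i.+1);
  ext_epi : epi (diff ext_seq n)
}.

Definition ext_morphism (n : nat) (X Y : C) (E E' : extension n X Y) : Prop :=
  exists phi : forall i, hom (E i) (E' i),
    [/\ forall i, i <= n -> phi i.+1 ∘ diff E i = diff E' i ∘ phi i,
        phi 0 ∘ ext_in E = ext_in E'
      & ext_out E' ∘ phi n.+1 = ext_out E].

Definition yoneda_eq (n : nat) (X Y : C) :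
    extension n X Y -> extension n X Y -> Prop :=
  clos_refl_sym_trans _ (@ext_morphism n X Y).

(* Ext^n(X, Y) = 0, where for n > 0 Ext^n(X, Y) is the group of Yoneda classes
   of n-extensions; it is trivial iff all n-extensions are equivalent. *)
Definition Ext_zero (n : nat) (X Y : C) : Prop :=
  if n is 0 then forall f : hom X Y, f = 0%R
  else forall E E' : extension n X Y, yoneda_eq E E'.

Definition right_approximation (M : subcat) (X M0 : C) (f : hom M0 X) : Prop :=
  M M0 /\ forall M' (g : hom M' X), M M' -> exists h, g = f ∘ h.

Definition left_approximation (M : subcat) (X M0 : C) (f : hom X M0) : Prop :=
  M M0 /\ forall M' (g : hom X M'), M M' -> exists h, g = h ∘ f.

Definition functorially_finite (M : subcat) : Prop :=
  (forall X, exists M0 (f : hom M0 X), right_approximation M f) /\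
  (forall X, exists M0 (f : hom X M0), left_approximation M f).

Definition generating (M : subcat) : Prop :=
  forall X, exists M0 (f : hom M0 X), M M0 /\ epi f.

Definition cogenerating (M : subcat) : Prop :=
  forall X, exists M0 (f : hom X M0), M M0 /\ mono f.

Definition cluster_tilting (n : nat) (M : subcat) : Prop :=
  [/\ iso_closed M, functorially_finite M, generating M /\ cogenerating M,
      (forall X, M X <->
         (forall M' i, M M' -> 0 < i < n -> Ext_zero i X M'))
    & (forall Y, M Y <->
         (forall M' i, M M' -> 0 < i < n -> Ext_zero i M' Y))].

(* (f^1, ..., f^n) is an n-cokernel of f^0, where f^i = diff S i. *)
Definition n_cokernel (n : nat) (M : subcat) (S : sequence) : Prop :=
  forall M', M M' ->
    (forall h : hom (S n.+1) M', h ∘ diff S n = 0%R -> h = 0%R) /\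
    (forall i, i < n -> forall h : hom (S i.+1) M',
       h ∘ diff S i = 0%R <-> exists h', h = h' ∘ diff S i.+1).

Definition n_kernel (n : nat) (M : subcat) (S : sequence) : Prop :=
  forall M', M M' ->
    (forall h : hom M' (S 0), diff S 0 ∘ h = 0%R -> h = 0%R) /\
    (forall i, i < n -> forall h : hom M' (S i.+1),
       diff S i.+1 ∘ h = 0%R <-> exists h', h = diff S i ∘ h').

Definition n_exact (n : nat) (M : subcat) (S : sequence) : Prop :=
  [/\ forall i, i <= n.+1 -> M (S i), n_cokernel n M S & n_kernel n M S].

(* Exactness of 0 -> Hom(U, S a) -> ... -> Hom(U, S b) -> 0, for a <= b: the
   guard [i < b] turns the map leaving Hom(U, S b) into the zero map. *)
Definition hom_exact (U : C) (S : sequence) (a b : nat) : Prop :=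
  let in_ker i (h : hom U (S i)) := i < b -> diff S i ∘ h = 0%R in
  (forall h : hom U (S a), in_ker a h -> h = 0%R) /\
  (forall i, a <= i < b -> forall h : hom U (S i.+1),
     in_ker i.+1 h <-> exists h', h = diff S i ∘ h').

(* The sequence is U^M = S 0 -> M = S 1 -> V^1 = S 2 -> ... -> V^n = S n.+1. *)
Definition n_torsion_class (n : nat) (M U : subcat) : Prop :=
  [/\ iso_closed U, subcat_le U M
    & forall M0, M M0 -> exists S : sequence,
        [/\ n_exact n M S, isomorphic (S 1) M0, U (S 0)
          & forall U0, U U0 -> hom_exact U0 S 2 n.+1]].

Definition torsion_sequence (T F : subcat) (X M Y : C)
    (i : hom X M) (p : hom M Y) : Prop :=
  [/\ short_exact i p, T X & F Y].

Definition torsion_pair (T F : subcat) : Prop :=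
  [/\ iso_closed T, iso_closed F,
      (forall X Y (f : hom X Y), T X -> F Y -> f = 0%R)
    & (forall M, exists X Y (i : hom X M) (p : hom M Y),
         torsion_sequence T F i p)].

Definition torsion_class (T : subcat) : Prop := exists F, torsion_pair T F.

Definition is_torsion_part (T F : subcat) (M X : C) : Prop :=
  exists Y (i : hom X M) (p : hom M Y), torsion_sequence T F i p.

(* {tM0 : M0 in M} and {coker(tM0 -> M0) : M0 in M}, up to isomorphism, for
   the torsion functor t of the torsion pair (T, F). *)
Definition torsion_parts (T F M : subcat) : subcat :=
  fun X => exists2 M0, M M0 & is_torsion_part T F M0 X.

Definition torsion_cokernels (T F M : subcat) : subcat :=
  fun Y => exists2 M0, M M0 &
    exists X (i : hom X M0) (p : hom M0 Y), torsion_sequence T F i p.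

Definition least_torsion_class (U T : subcat) : Prop :=
  [/\ torsion_class T, subcat_le U T
    & forall T', torsion_class T' -> subcat_le U T' -> subcat_le T T'].

Definition torsion_closure (U : subcat) : subcat :=
  fun X => forall T, torsion_class T -> subcat_le U T -> T X.

End Categories.

Notation "U ⊆ V" := (subcat_le U V) : cat_scope.
Notation "U ≡ V" := (subcat_eq U V) : cat_scope.

(* Main.v *)
From Stdlib Require Import Relation_Operators ClassicalEpsilon Permutation List.
From mathcomp Require Import all_boot all_algebra zify.
Require Import Defs.

(** For an n-torsion class U with torsion pair (T(U), U^perp), the kernel
    U^M -> M of the defining n-exact sequence is the torsion part tM, because
    Hom(U, V^1) -> Hom(U, V^2) being injective means Hom(U, M/U^M) = 0.  Hence
    U = {tM} is recovered from T(U).  Cutting the n-exact sequence into short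
    exact sequences and shifting dimensions (Ext^i(U, V^j) = 0 for 0 < i < n),
    exactness of Hom(U, V^2) -> ... -> Hom(U, V^n) -> 0 becomes
    Ext^(n-1)(U, M/tM) = 0.  Conversely, from tM in M one obtains the n-exact
    sequence by iterating left M-approximations of M/tM; dimension shifting in
    the opposite category shows that the last cokernel lies in M.

    Since there need not be enough projectives or injectives, the long exact
    sequences are established for formal sums of Yoneda extensions, whose
    vanishing is defined by effacement. *)

Set Implicit Arguments.
Unset Strict Implicit.
Unset Printing Implicit Defensive.

Local Open Scope cat_scope.

(** * Abelian categories *)

(** The condition [Ext_zero] concerns Yoneda classes and carries no addition, whereas dimension
    shifting needs additive exact sequences; [Ext_null] is the additive substitute. [Ext_zero]
    always implies [Ext_null], since every chain of short exact sequences is realised by an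
    extension. The converse is proved in degree 1, where all extensions split, and in degrees below
    n for an X with Ext^i(X, M) = 0 for 0 < i < n: as M is cogenerating, the first middle term of an
    extension embeds in an object of M, which lowers the degree by one.

    Both variances are needed: covariant shifting for lifting maps out of U, contravariant shifting
    for the last cosyzygy. Everything is proved covariantly and applied to [op C], at the price of
    reversing Yoneda extensions.

    An n-exact sequence is tested only against M; that M is generating and cogenerating makes it
    exact in the ambient category. Finite length enters through the existence of the torsion pair
    generated by U. *)

Definition op (C : preadditive) : preadditive :=
  @Preadditive (obj C) (fun X Y => hom Y X) (fun X => idm X)
    (fun X Y Z g f => f ∘ g)
    (fun _ _ _ _ h g f => esym (compA f g h))
    (fun _ _ f => compm1 f) (fun _ _ f => comp1m f)
    (fun _ _ _ g g' f => compDr f g g') (fun _ _ _ g f f' => compDl f f' g).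

Section Preadditive.
Local Open Scope ring_scope.
Import GRing.Theory.
Variable C : preadditive.
Implicit Types A B E K P Q W X Y Z : C.

Lemma comp0m X Y Z (f : hom X Y) : (0 : hom Y Z) ∘ f = 0.
Proof. by apply: (@addrI _ (0 ∘ f)); rewrite -compDl !addr0. Qed.

Lemma compm0 X Y Z (g : hom Y Z) : g ∘ (0 : hom X Y) = 0.
Proof. by apply: (@addrI _ (g ∘ 0)); rewrite -compDr !addr0. Qed.

Lemma compNm X Y Z (g : hom Y Z) (f : hom X Y) : (- g) ∘ f = - (g ∘ f).
Proof. by apply/eqP; rewrite -addr_eq0 -compDl addNr comp0m. Qed.

Lemma compmN X Y Z (g : hom Y Z) (f : hom X Y) : g ∘ (- f) = - (g ∘ f).
Proof. by apply/eqP; rewrite -addr_eq0 -compDr addNr compm0. Qed.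

Lemma compBl X Y Z (g g' : hom Y Z) (f : hom X Y) :
  (g - g') ∘ f = g ∘ f - g' ∘ f.
Proof. by rewrite compDl compNm. Qed.

Lemma compBr X Y Z (g : hom Y Z) (f f' : hom X Y) :
  g ∘ (f - f') = g ∘ f - g ∘ f'.
Proof. by rewrite compDr compmN. Qed.

Lemma mono0 X Y (f : hom X Y) :
  (forall W (x : hom W X), f ∘ x = 0 -> x = 0) -> mono f.
Proof.
move=> f0 W g h fgh; apply/eqP; rewrite -subr_eq0; apply/eqP; apply: f0.
by rewrite compBr fgh subrr.
Qed.

Lemma mono_eq0 X Y (f : hom X Y) W (x : hom W X) : mono f -> f ∘ x = 0 -> x = 0.
Proof. by move=> mf fx; apply: mf; rewrite fx compm0. Qed.

Lemma epi0 X Y (f : hom X Y) :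
  (forall W (x : hom Y W), x ∘ f = 0 -> x = 0) -> epi f.
Proof.
move=> f0 W g h fgh; apply/eqP; rewrite -subr_eq0; apply/eqP; apply: f0.
by rewrite compBl fgh subrr.
Qed.

Lemma epi_eq0 X Y (f : hom X Y) W (x : hom Y W) : epi f -> x ∘ f = 0 -> x = 0.
Proof. by move=> mf fx; apply: mf; rewrite fx comp0m. Qed.

Lemma mono_comp X Y Z (g : hom Y Z) (f : hom X Y) :
  mono g -> mono f -> mono (g ∘ f).
Proof. by move=> mg mf W x y; rewrite -!compA => /mg /mf. Qed.

Lemma epi_comp X Y Z (g : hom Y Z) (f : hom X Y) :
  epi g -> epi f -> epi (g ∘ f).
Proof. by move=> eg ef W x y; rewrite !compA => /ef /eg. Qed.

Lemma mono_compr X Y Z (g : hom Y Z) (f : hom X Y) : mono (g ∘ f) -> mono f.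
Proof. by move=> m W x y e; apply: m; rewrite -!compA e. Qed.

Lemma epi_compl X Y Z (g : hom Y Z) (f : hom X Y) : epi (g ∘ f) -> epi g.
Proof. by move=> m W x y e; apply: m; rewrite !compA e. Qed.

Lemma iso_id X : is_iso (idm X).
Proof. by exists (idm X); rewrite comp1m. Qed.

Lemma iso_comp X Y Z (g : hom Y Z) (f : hom X Y) :
  is_iso g -> is_iso f -> is_iso (g ∘ f).
Proof.
move=> [g' [g'g gg']] [f' [f'f ff']]; exists (f' ∘ g'); split.
  by rewrite -compA (compA g') g'g comp1m.
by rewrite -compA (compA f) ff' comp1m.
Qed.

Lemma iso_mono X Y (f : hom X Y) : is_iso f -> mono f.
Proof.
move=> [f' [f'f _]] W g h e.
by rewrite -(comp1m g) -(comp1m h) -f'f -!compA e.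
Qed.

Lemma iso_epi X Y (f : hom X Y) : is_iso f -> epi f.
Proof.
move=> [f' [_ ff']] W g h e.
by rewrite -(compm1 g) -(compm1 h) -ff' !compA e.
Qed.

Lemma isomorphic_refl X : isomorphic X X.
Proof. by exists (idm X); apply: iso_id. Qed.

Lemma isomorphic_sym X Y : isomorphic X Y -> isomorphic Y X.
Proof. by move=> [f [g [gf fg]]]; exists g, f. Qed.

Lemma kernel_mono X Y K (f : hom X Y) (k : hom K X) : is_kernel f k -> mono k.
Proof.
move=> [fk0 fkP] W g h e.
have [|t [_ tP]] := fkP _ (k ∘ g); first by rewrite compA fk0 comp0m.
by rewrite -(tP g) // -(tP h).
Qed.

Lemma cokernel_epi X Y Q (f : hom X Y) (c : hom Y Q) : is_cokernel f c -> epi c.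
Proof.
move=> [fk0 fkP] W g h e.
have [|t [_ tP]] := fkP _ (g ∘ c); first by rewrite -compA fk0 compm0.
by rewrite -(tP g) // -(tP h).
Qed.

Lemma kernel_lift X Y K (f : hom X Y) (k : hom K X) W (h : hom W X) :
  is_kernel f k -> f ∘ h = 0 -> exists h', h = k ∘ h'.
Proof. by move=> [_ kP] /kP [h' [<- _]]; exists h'. Qed.

Lemma cokernel_desc X Y Q (f : hom X Y) (c : hom Y Q) W (h : hom Y W) :
  is_cokernel f c -> h ∘ f = 0 -> exists h', h = h' ∘ c.
Proof. by move=> [_ kP] /kP [h' [<- _]]; exists h'. Qed.

Lemma kernelP X Y K (f : hom X Y) (k : hom K X) : mono k -> f ∘ k = 0 ->
  (forall W (h : hom W X), f ∘ h = 0 -> exists h', h = k ∘ h') -> is_kernel f k.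
Proof.
move=> mk fk0 kP; split=> // W h /kP [h' ->]; exists h'; split=> // h''.
by move/mk.
Qed.

Lemma cokernelP X Y Q (f : hom X Y) (c : hom Y Q) : epi c -> c ∘ f = 0 ->
  (forall W (h : hom Y W), h ∘ f = 0 -> exists h', h = h' ∘ c) ->
  is_cokernel f c.
Proof.
move=> mk fk0 kP; split=> // W h /kP [h' ->]; exists h'; split=> // h''.
by move/mk.
Qed.

Lemma ses_comp0 A B K (a : hom A B) (c : hom B K) : short_exact a c -> c ∘ a = 0.
Proof. by case=> -[]. Qed.

Lemma ses_mono A B K (a : hom A B) (c : hom B K) : short_exact a c -> mono a.
Proof. by case=> /kernel_mono. Qed.

Lemma ses_epi A B K (a : hom A B) (c : hom B K) : short_exact a c -> epi c.
Proof. by case=> _ /cokernel_epi. Qed.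

End Preadditive.

Lemma abelian_op (C : preadditive) : abelian C -> abelian (op C).
Proof.
case=> -[Z [Z0 Z0']] Hbip Hker Hmono Hepi; split.
- by exists Z.
- move=> X Y; have [P [i [j [p [q [pi qj qi pj e]]]]]] := Hbip X Y.
  by exists P, p, q, i, j.
- by move=> X Y f; have [] := Hker Y X f.
- by move=> X Y f; apply: Hepi.
- by move=> X Y f; apply: Hmono.
Qed.

Section Abelian.
Local Open Scope ring_scope.
Import GRing.Theory.
Variable C : preadditive.
Hypothesis Cab : abelian C.
Implicit Types A B E K P Q W X Y Z : C.

Lemma has_zero : exists Z : C, is_zero Z. Proof. by case: Cab. Qed.

Lemma has_biproduct X Y : exists (P : C) (i : hom X P) (j : hom Y P)
  (p : hom P X) (q : hom P Y), is_biproduct i j p q.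
Proof. by case: Cab. Qed.

Lemma has_kernel X Y (f : hom X Y) : exists (K : C) (k : hom K X), is_kernel f k.
Proof. by case: Cab => _ _ /(_ _ _ f)[]. Qed.

Lemma has_cokernel X Y (f : hom X Y) :
  exists (Q : C) (c : hom Y Q), is_cokernel f c.
Proof. by case: Cab => _ _ /(_ _ _ f)[]. Qed.

Lemma mono_cokernel_ses A B K (a : hom A B) (c : hom B K) :
  mono a -> is_cokernel a c -> short_exact a c.
Proof.
move=> ma ac; split=> //; case: Cab => _ _ _ /(_ _ _ a ma)[Z [g ga]] _.
have [g' eg] := cokernel_desc ac (proj1 ga).
apply: kernelP => // [|W h ch]; first by case: ac.
by apply: (kernel_lift ga); rewrite eg -compA ch compm0.
Qed.

Lemma epi_kernel_ses A B K (a : hom A B) (c : hom B K) :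
  epi c -> is_kernel c a -> short_exact a c.
Proof.
move=> ec ca; split=> //; case: Cab => _ _ _ _ /(_ _ _ c ec)[Z [g gc]].
have [g' eg] := kernel_lift ca (proj1 gc).
apply: cokernelP => // [|W h hc]; first by case: ca.
by apply: (cokernel_desc gc); rewrite eg compA hc comp0m.
Qed.

Lemma mono_ses A B (a : hom A B) :
  mono a -> exists (K : C) (c : hom B K), short_exact a c.
Proof.
move=> ma; have [K [c ac]] := has_cokernel a.
by exists K, c; apply: mono_cokernel_ses.
Qed.

Lemma epi_ses B K (c : hom B K) :
  epi c -> exists (A : C) (a : hom A B), short_exact a c.
Proof.
move=> ma; have [A [a ac]] := has_kernel c.
by exists A, a; apply: epi_kernel_ses.
Qed.

(** The image m is the kernel of the cokernel of f. For e epi: if t e = 0, then f factors through m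
    j with j = ker t; the cokernel w of m j kills f, hence m, so m factors through m j and j has a
    right inverse, which forces t = 0. *)
Lemma image_factor X Y (f : hom X Y) :
  exists (I : C) (e : hom X I) (m : hom I Y), [/\ epi e, mono m & f = m ∘ e].
Proof.
have [Q [c fc]] := has_cokernel f; have [I [m cm]] := has_kernel c.
have [e fe] := kernel_lift cm (proj1 fc).
exists I, e, m; split=> //; last exact: kernel_mono cm.
apply: epi0 => W t te0; have [J [j tj]] := has_kernel t.
have [e' ee'] := kernel_lift tj te0.
have mmj : mono (m ∘ j).
  by apply: mono_comp; [apply: kernel_mono cm|apply: kernel_mono tj].
have [R [w mjw]] := mono_ses mmj.
have [|w' ww'] := cokernel_desc (h := w) fc.
  by rewrite fe ee' (compA m) compA (ses_comp0 mjw) comp0m.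
have [|r mr] := kernel_lift (h := m) (proj1 mjw).
  by rewrite ww' -compA (proj1 cm) compm0.
have jr : j ∘ r = idm I.
  by apply: (kernel_mono cm); rewrite compm1 compA -mr.
by rewrite -(compm1 t) -jr compA (proj1 tj) comp0m.
Qed.

Lemma mono_epi_iso X Y (f : hom X Y) : mono f -> epi f -> is_iso f.
Proof.
move=> mf ef; have [K [c fc]] := mono_ses mf.
have c0 : c = 0 by apply: (epi_eq0 ef); apply: ses_comp0 fc.
have [|g fg] := kernel_lift (h := idm Y) (proj1 fc); first by rewrite compm1.
by exists g; split=> //; apply: mf; rewrite compA -fg comp1m compm1.
Qed.

(** B' is the cokernel of (a, -g) : Y -> B (+) Z. *)
Lemma ses_pushout Y B K Z (a : hom Y B) (c : hom B K) (g : hom Y Z) :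
  short_exact a c -> exists B' (a' : hom Z B') (c' : hom B' K) (u : hom B B'),
    [/\ short_exact a' c', u ∘ a = a' ∘ g & c' ∘ u = c].
Proof.
move=> ac; have [P [i [j [p [q [pi qj qi pj ijpq]]]]]] := has_biproduct B Z.
pose w := i ∘ a - j ∘ g.
have pw : p ∘ w = a by rewrite compBr !compA pi pj comp1m comp0m subr0.
have qw : q ∘ w = - g by rewrite compBr !compA qj qi comp1m comp0m sub0r.
have mw : mono w by apply: (@mono_compr _ _ _ _ p); rewrite pw; apply: ses_mono ac.
have [B' [s ws]] := mono_ses mw.
have es := ses_epi ws.
have [|c' cc'] := cokernel_desc (h := c ∘ p) (proj2 ws).
  by rewrite -compA pw (ses_comp0 ac).
have c'u : c' ∘ (s ∘ i) = c by rewrite compA -cc' -compA pi compm1.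
have c'a' : c' ∘ (s ∘ j) = 0 by rewrite compA -cc' -compA pj compm0.
have uag : s ∘ i ∘ a = s ∘ j ∘ g.
  by apply/eqP; rewrite -subr_eq0 -!compA -compBr -/w (ses_comp0 ws).
exists B', (s ∘ j), c', (s ∘ i); split=> //; apply: mono_cokernel_ses.
  apply: mono0 => W x; rewrite -compA => /(kernel_lift (proj1 ws))[y xy].
  have y0 : y = 0.
    by apply: (mono_eq0 (ses_mono ac)); rewrite -pw -compA -xy compA pj comp0m.
  by rewrite -(comp1m x) -qj -compA xy y0 !compm0.
apply: cokernelP => // [|W h ha'].
  by apply: (@epi_compl _ _ _ _ _ (s ∘ i)); rewrite c'u; apply: ses_epi ac.
have [|h' hh'] := cokernel_desc (h := h ∘ (s ∘ i)) (proj2 ac).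
  by rewrite -compA uag compA ha' comp0m.
exists h'; apply: es; rewrite -compA -cc' compA -hh'.
rewrite -(compm1 (h ∘ s)) -ijpq compDr !compA -(compA h s j) ha' comp0m addr0 // !compA.
Qed.

(* A morphism of short exact sequences with identical first terms gives a
   bicartesian square, hence a short exact sequence B -> K (+) B' -> K'. *)
Lemma ses_cone A B K B' K' (a : hom A B) (c : hom B K) (a' : hom A B')
    (c' : hom B' K') (u : hom B B') (v : hom K K')
    P (i : hom K P) (j : hom B' P) (p : hom P K) (q : hom P B') :
  short_exact a c -> short_exact a' c' -> u ∘ a = a' -> v ∘ c = c' ∘ u ->
  is_biproduct i j p q ->
  short_exact (i ∘ c - j ∘ u) (v ∘ p + c' ∘ q).
Proof.
move=> ac ac' ua vc [pi qj qi pj ijpq].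
have pw : p ∘ (i ∘ c - j ∘ u) = c.
  by rewrite compBr !compA pi pj comp1m comp0m subr0.
have qw : q ∘ (i ∘ c - j ∘ u) = - u.
  by rewrite compBr !compA qi qj comp1m comp0m sub0r.
have ri : (v ∘ p + c' ∘ q) ∘ i = v.
  by rewrite compDl -!compA pi qi compm1 compm0 addr0.
have rj : (v ∘ p + c' ∘ q) ∘ j = c'.
  by rewrite compDl -!compA pj qj compm1 compm0 add0r.
apply: mono_cokernel_ses.
  apply: mono0 => W x x0.
  have cx : c ∘ x = 0 by rewrite -pw -compA x0 compm0.
  have ux : u ∘ x = 0.
    by apply/eqP; rewrite -oppr_eq0 -compNm -qw -compA x0 compm0.
  have [y xy] := kernel_lift (proj1 ac) cx; rewrite xy compA ua in ux.
  by rewrite xy (mono_eq0 (ses_mono ac') ux) compm0.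
apply: cokernelP.
- by apply: (@epi_compl _ _ _ _ _ j); rewrite rj; apply: ses_epi ac'.
- by rewrite compDl -!compA pw qw compmN vc subrr.
move=> W h hw.
have hic : h ∘ i ∘ c = h ∘ j ∘ u.
  by apply/eqP; rewrite -subr_eq0 -!compA -compBr hw.
have [|t ht] := cokernel_desc (h := h ∘ j) (proj2 ac').
  by rewrite -ua compA -hic -!compA (ses_comp0 ac) !compm0.
have tv : t ∘ v = h ∘ i.
  by apply: (ses_epi ac); rewrite -compA vc hic ht !compA.
by exists t; rewrite -(compm1 h) -ijpq !compDr !compA tv ht.
Qed.

(** Stands in for choosing a preimage of an element: x lifts along c after passing to a cover w of
    W. Here V is the pullback, the kernel of (c, -x) : B (+) W -> K. *)
Lemma epi_lift B K W (c : hom B K) (x : hom W K) : epi c ->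
  exists V (w : hom V W) (y : hom V B), epi w /\ x ∘ w = c ∘ y.
Proof.
move=> ec; have [P [i [j [p [q [pi qj qi pj ijpq]]]]]] := has_biproduct B W.
pose r := c ∘ p - x ∘ q.
have ri : r ∘ i = c by rewrite compBl -!compA pi qi compm1 compm0 subr0.
have rj : r ∘ j = - x by rewrite compBl -!compA pj qj compm1 compm0 sub0r.
have er : epi r by apply: (@epi_compl _ _ _ _ _ i); rewrite ri.
have [V [k kr]] := epi_ses er.
exists V, (q ∘ k), (p ∘ k); split; last first.
  apply/eqP; rewrite eq_sym -subr_eq0 !compA -compBl -/r.
  by rewrite (ses_comp0 kr).
apply: epi0 => Z t; rewrite compA => /(cokernel_desc (proj2 kr))[t' tt'].
have t'0 : t' = 0.
  by apply: (epi_eq0 ec); rewrite -ri compA -tt' -compA qi compm0.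
by rewrite -(compm1 t) -qj compA tt' t'0 !comp0m.
Qed.

(* Third isomorphism theorem: (P/A)/(B/A) = P/B. *)
Lemma ses_third A B K P E Q (a : hom A B) (c : hom B K) (b : hom B P)
    (p : hom P E) (q : hom P Q) :
  short_exact a c -> short_exact b p -> short_exact (b ∘ a) q ->
  exists (m : hom K Q) (e : hom Q E),
    [/\ short_exact m e, m ∘ c = q ∘ b & e ∘ q = p].
Proof.
move=> ac bp bq.
have [|m mc] := cokernel_desc (h := q ∘ b) (proj2 ac).
  by rewrite -compA (ses_comp0 bq).
have [|e eq] := cokernel_desc (h := p) (proj2 bq).
  by rewrite compA (ses_comp0 bp) comp0m.
exists m, e; split=> //; apply: mono_cokernel_ses.
  apply: mono0 => W x mx0.
  have [V [w [y [ew xw]]]] := epi_lift x (ses_epi ac).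
  have [|z yz] := kernel_lift (h := b ∘ y) (proj1 bq).
    by rewrite compA mc -compA -xw compA mx0 comp0m.
  have {}yz : y = a ∘ z by apply: (ses_mono bp); rewrite yz compA.
  by apply: (epi_eq0 ew); rewrite xw yz compA (ses_comp0 ac) comp0m.
apply: cokernelP.
- by apply: (@epi_compl _ _ _ _ _ q); rewrite -eq; apply: ses_epi bp.
- by apply: (epi_eq0 (ses_epi ac)); rewrite -compA -mc compA -eq (ses_comp0 bp).
move=> W s sm.
have [|s' ss'] := cokernel_desc (h := s ∘ q) (proj2 bp).
  by rewrite -compA mc compA sm comp0m.
by exists s'; apply: (ses_epi bq); rewrite ss' {1}eq compA.
Qed.

Lemma ses_to_zero Y Z : is_zero Z -> short_exact (idm Y) (0 : hom Y Z).
Proof.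
move=> [Z0 Z0']; apply: mono_cokernel_ses; first exact/iso_mono/iso_id.
apply: cokernelP => [W g h _||W h]; first by rewrite (Z0' _ g) (Z0' _ h).
  by rewrite comp0m.
by rewrite compm1 => ->; exists 0; rewrite comp0m.
Qed.

End Abelian.

(** * Extension groups as satellites *)

(** The index system of the satellite colimit: monomorphisms out of Y, each with a chosen
    cokernel. *)
Record ses (C : preadditive) (Y : C) := Ses {
  sB : C; sK : C; sa : hom Y sB; sc : hom sB sK; sP : short_exact sa sc }.

Section ExtSums.
Local Open Scope ring_scope.
Local Open Scope list_scope.
Local Notation "s1 ++ s2" := (app s1 s2) : seq_scope.
Import GRing.Theory.
Variable C : preadditive.
Hypothesis Cab : abelian C.
Implicit Types A B E K P Q W Y Z : C.

Lemma ses_desc Y Z (s1 : ses Y) (s3 : ses Z) (g : hom Y Z)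
    (u : hom (sB s1) (sB s3)) :
  u ∘ sa s1 = sa s3 ∘ g -> exists v, v ∘ sc s1 = sc s3 ∘ u.
Proof.
move=> ug; have [|v ->] := cokernel_desc (h := sc s3 ∘ u) (proj2 (sP s1)).
  by rewrite -compA ug compA (ses_comp0 (sP s3)) comp0m.
by exists v.
Qed.

(** Directedness of the index system, twisted by g: the middle term of [s3] is the pushout of [s1]
    along [sa s2 ∘ g], so it receives both middle terms. *)
Lemma ses_common Y Z (s1 : ses Y) (s2 : ses Z) (g : hom Y Z) :
  exists (s3 : ses Z) u1 v1 u2 v2,
    [/\ u1 ∘ sa s1 = sa s3 ∘ g, v1 ∘ sc s1 = sc s3 ∘ u1,
        u2 ∘ sa s2 = sa s3 & v2 ∘ sc s2 = sc s3 ∘ u2].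
Proof.
have [B [a [c [u [ac ua _]]]]] := ses_pushout Cab (sa s2 ∘ g) (sP s1).
have ma : mono (a ∘ sa s2).
  by apply: mono_comp; [apply: ses_mono ac|apply: ses_mono (sP s2)].
have [K [c3 s3P]] := mono_ses Cab ma.
pose s3 := Ses s3P; have u1P : u ∘ sa s1 = sa s3 ∘ g by rewrite ua /= compA.
have [v1 v1P] := @ses_desc _ _ s1 s3 g u u1P.
have u2P : a ∘ sa s2 = sa s3 ∘ idm Z by rewrite compm1.
have [v2 v2P] := @ses_desc _ _ s2 s3 (idm Z) a u2P.
by exists s3, u, v1, a, v2.
Qed.

(* An element of Ext^i(X, Y) is represented by i composable short exact
   sequences starting at Y together with a map from X to the last cokernel;
   [item i Z] is such an element together with a map Y -> Z along which it is
   to be pushed forward, and a list of items represents the sum. *)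
Variable X : C.

Fixpoint chain i Y : Type :=
  if i is i'.+1 then {s : ses Y & chain i' (sK s)} else hom X Y.

Record item i Z := Item { iY : C; iel : chain i iY; ih : hom iY Z }.

Definition pushi i Z Z' (g : hom Z Z') (x : item i Z) : item i Z' :=
  Item (iel x) (g ∘ ih x).

Definition push i Z Z' (g : hom Z Z') (l : list (item i Z)) : list (item i Z') :=
  List.map (pushi g) l.

Definition neg i Z (l : list (item i Z)) := push (- idm Z) l.

(** [x'] is a preimage of [x] under the connecting map Ext^i(X, sK s) -> Ext^(i+1)(X, Z) of [s],
    obtained by mapping the first sequence of the chain to [s] over [ih x]. *)
Definition lifti i Z (s : ses Z) (x : item i.+1 Z) (x' : item i (sK s)) : Prop :=
  exists u v, [/\ x' = Item (projT2 (iel x)) v,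
    u ∘ sa (projT1 (iel x)) = sa s ∘ ih x & v ∘ sc (projT1 (iel x)) = sc s ∘ u].

Arguments lifti {i Z} s x x'.

Definition lift i Z (s : ses Z) (l : list (item i.+1 Z)) l' : Prop :=
  Forall2 (lifti s) l l'.
Arguments lift {i Z} s l l'.

Definition sum0 Z (l : list (item 0 Z)) : hom X Z :=
  fold_right (fun (x : item 0 Z) r => ih x ∘ iel x + r) 0 l.

(* The sum of the list vanishes in Ext^i(X, Z): Ext^(i+1)(X, Z) is the colimit
   over the monomorphisms Z -> B of coker(Ext^i(X, B) -> Ext^i(X, B/Z)). *)
Fixpoint null i : forall Z, list (item i Z) -> Prop :=
  if i is i'.+1 then
    fun Z l => exists (s : ses Z) l' m,
      lift s l l' /\ null (l' ++ push (sc s) m)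
  else fun Z l => sum0 l = 0.

(** * Pushforward, signs and lifting of formal sums *)

Lemma push_app i Z Z' (g : hom Z Z') (l1 l2 : list (item i Z)) :
  push g (l1 ++ l2) = push g l1 ++ push g l2.
Proof. exact: map_app. Qed.

Lemma push_push i Z Z' Z'' (g : hom Z Z') (h : hom Z' Z'') (l : list (item i Z)) :
  push h (push g l) = push (h ∘ g) l.
Proof.
by rewrite /push List.map_map; apply: List.map_ext => x; rewrite /pushi compA.
Qed.

Lemma push_id i Z (l : list (item i Z)) : push (idm Z) l = l.
Proof.
rewrite -[RHS]List.map_id; apply: List.map_ext => -[Y e h].
by rewrite /pushi comp1m.
Qed.

Lemma push_neg i Z Z' (g : hom Z Z') (l : list (item i Z)) :
  push g (neg l) = neg (push g l).
Proof. by rewrite /neg !push_push compmN compNm comp1m compm1. Qed.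

Lemma neg_app i Z (l1 l2 : list (item i Z)) : neg (l1 ++ l2) = neg l1 ++ neg l2.
Proof. exact: push_app. Qed.

Lemma neg_neg i Z (l : list (item i Z)) : neg (neg l) = l.
Proof. by rewrite /neg push_push compmN compm1 opprK push_id. Qed.

Lemma lifti_push i Y Z (s : ses Y) (s' : ses Z) (g : hom Y Z) u v
    (x : item i.+1 Y) x' :
  u ∘ sa s = sa s' ∘ g -> v ∘ sc s = sc s' ∘ u ->
  lifti s x x' -> lifti s' (pushi g x) (pushi v x').
Proof.
move=> ug vu [w [t [-> wP tP]]]; exists (u ∘ w), (v ∘ t); split=> //=.
  by rewrite -compA wP compA ug compA.
by rewrite -compA tP compA vu compA.
Qed.

Lemma lift_push i Y Z (s : ses Y) (s' : ses Z) (g : hom Y Z) u v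
    (l : list (item i.+1 Y)) l' :
  u ∘ sa s = sa s' ∘ g -> v ∘ sc s = sc s' ∘ u ->
  lift s l l' -> lift s' (push g l) (push v l').
Proof.
move=> ug vu; elim=> [|x x' {}l {}l' xx' _ IH]; first exact: Forall2_nil.
by apply: Forall2_cons IH; exact: lifti_push ug vu xx'.
Qed.

Lemma lift_neg i Z (s : ses Z) (l : list (item i.+1 Z)) l' :
  lift s l l' -> lift s (neg l) (neg l').
Proof.
by apply: (@lift_push _ _ _ _ _ _ (- idm _)); rewrite compNm compmN comp1m compm1.
Qed.

Lemma lift_enlarge i Z (s s' : ses Z) u v (l : list (item i.+1 Z)) l' :
  u ∘ sa s = sa s' -> v ∘ sc s = sc s' ∘ u -> lift s l l' -> lift s' l (push v l').
Proof.
move=> us vs ll'; rewrite -[l]push_id.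
by apply: (lift_push _ vs ll'); rewrite compm1.
Qed.

Lemma lift_exists i Z (s0 : ses Z) (l : list (item i.+1 Z)) :
  exists (s : ses Z) l' u v,
    [/\ lift s l l', u ∘ sa s0 = sa s & v ∘ sc s0 = sc s ∘ u].
Proof.
elim: l => [|x l [s [l' [u [v [ll' us vs]]]]]].
  by exists s0, nil, (idm _), (idm _); split; rewrite ?comp1m ?compm1.
have [s3 [u1 [v1 [u2 [v2 [e1 e2 e3 e4]]]]]] :=
  ses_common (projT1 (iel x)) s (ih x).
exists s3, (Item (projT2 (iel x)) v1 :: push v2 l'), (u2 ∘ u), (v2 ∘ v); split.
- apply: Forall2_cons; first by exists u1, v1.
  exact: lift_enlarge e3 e4 ll'.
- by rewrite -compA us.
- by rewrite -compA vs compA e4 compA.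
Qed.

(** * Calculus of vanishing formal sums *)

Lemma null_perm i Z (l l' : list (item i Z)) :
  Permutation l l' -> null l -> null l'.
Proof.
elim: i Z l l' => [|i IH] Z l l' ll' /=.
  suff -> : sum0 l = sum0 l' by [].
  by elim: ll' => //= [x ? ? _ -> //|x y ?|? ? ? _ -> _ -> //]; rewrite addrCA.
move=> [s [k [m [lk nk]]]]; have [k' [kk' lk']] := Permutation_Forall2 ll' lk.
by exists s, k', m; split=> //; apply: IH nk; apply: Permutation_app_tail.
Qed.

(** The singleton case is separate so that [flat env s] reduces to the blocks without a trailing
    [++ nil] and matches goals by conversion. *)
Fixpoint flat (T : Type) (env : seq (list T)) (s : seq nat) : list T :=
  match s with
  | nil => nil
  | j :: nil => seq.nth nil env j
  | j :: s' => seq.nth nil env j ++ flat env s'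
  end.

Lemma flat_perm (T : Type) (env : seq (list T)) (s t : seq nat) :
  perm_eq s t -> Permutation (flat env s) (flat env t).
Proof.
have flat_cons r j : flat env (j :: r) = seq.nth nil env j ++ flat env r.
  by case: r => //=; rewrite List.app_nil_r.
elim: s t => [|j s IH] t; first by move/perm_size/esym/size0nil->.
move=> st; have jt : j \in t by rewrite -(perm_mem st) mem_head.
move: jt st; case/splitPr => t1 t2 st.
have {}st : perm_eq s (cat t1 t2).
  rewrite -(perm_cons j); apply: (perm_trans st).
  by rewrite perm_catC /= perm_cons perm_catC.
rewrite flat_cons (IH _ st).
elim: t1 {st} => [|k t1 IHt]; first by rewrite -flat_cons.
rewrite [cat _ _]/= [cat (k :: t1) _]/= !flat_cons -IHt !List.app_assoc.
exact/Permutation_app_tail/Permutation_app_comm.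
Qed.

(* Rearranges sums: [s] and [t] list the positions of the blocks in [env]. *)
Lemma null_flat i Z (env : seq (list (item i Z))) (s t : seq nat) :
  perm_eq s t -> null (flat env s) -> null (flat env t).
Proof. by move/(flat_perm env)/null_perm. Qed.

Arguments flat_perm {T} env s t _.
Arguments null_flat {i Z} env s t _ _.

Lemma sum0_app Z (l1 l2 : list (item 0 Z)) : sum0 (l1 ++ l2) = sum0 l1 + sum0 l2.
Proof. by elim: l1 => [|x l1 /= ->]; rewrite ?add0r ?addrA. Qed.

Lemma sum0_push Z Z' (g : hom Z Z') (l : list (item 0 Z)) :
  sum0 (push g l) = g ∘ sum0 l.
Proof. by elim: l => [|x l /= ->]; rewrite ?compm0 ?compDr ?compA. Qed.

Lemma sum0_neg Z (l : list (item 0 Z)) : sum0 (neg l) = - sum0 l.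
Proof. by rewrite sum0_push compNm comp1m. Qed.

(** Pushing [s] out along g leaves its cokernel unchanged, so the lift [l'] still serves and only
    the correcting sum [m] moves. *)
Lemma null_push i Z Z' (g : hom Z Z') (l : list (item i Z)) :
  null l -> null (push g l).
Proof.
elim: i Z Z' g l => [|i IH] Z Z' g l /=; first by rewrite sum0_push => ->; rewrite compm0.
move=> [s [l' [m [ll' nl']]]].
have [B' [a' [c' [u [ac' ua cu]]]]] := ses_pushout Cab g (sP s).
exists (Ses ac'), l', (push u m); split; last by rewrite push_push cu.
rewrite -[l']push_id; apply: lift_push ll'; first exact: ua.
by rewrite comp1m cu.
Qed.

Lemma null_app i Z (l1 l2 : list (item i Z)) : null l1 -> null l2 -> null (l1 ++ l2).
Proof.
elim: i Z l1 l2 => [|i IH] Z l1 l2 /=; first by rewrite sum0_app => -> ->; rewrite addr0.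
move=> [s1 [l1' [m1 [ll1 nl1]]]] [s2 [l2' [m2 [ll2 nl2]]]].
have [s3 [u1 [v1 [u2 [v2 [e1 e2 e3 e4]]]]]] := ses_common s1 s2 (idm Z).
rewrite compm1 in e1.
exists s3, (push v1 l1' ++ push v2 l2'), (push u1 m1 ++ push u2 m2); split.
  by apply: Forall2_app; apply: lift_enlarge; eauto.
apply: (null_perm _ (IH _ _ _ (null_push v1 nl1) (null_push v2 nl2))).
rewrite !push_app !push_push e2 e4 -!List.app_assoc.
exact: (flat_perm [:: _; _; _; _] [:: 0; 1; 2; 3] [:: 0; 2; 1; 3]).
Qed.

Lemma null_appC i Z (l1 l2 : list (item i Z)) : null (l1 ++ l2) -> null (l2 ++ l1).
Proof. exact/null_perm/Permutation_app_comm. Qed.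

Lemma null_neg i Z (l : list (item i Z)) : null l -> null (neg l).
Proof. exact: null_push. Qed.

Lemma null_merge i Z Y (e : chain i Y) (g g' : hom Y Z) (l : list (item i Z)) :
  null (Item e g :: Item e g' :: l) -> null (Item e (g + g') :: l).
Proof.
elim: i Z Y e g g' l => [|i IH] Z Y e g g' l /=; first by rewrite compDl addrA.
move=> [s [l' [m [ll' nl']]]]; move: nl'.
inversion ll' as [|? x ? k [u [v [-> uP vP]]] ll2]; subst.
inversion ll2 as [|? x ? k2 [u' [v' [-> uP' vP']]] ll3]; subst.
move=> /= /IH n; exists s, (Item (projT2 e) (v + v') :: k2), m; split=> //.
apply: Forall2_cons => //; exists (u + u'), (v + v').
by split; rewrite // ?compDl ?compDr ?uP ?uP' ?vP ?vP'.
Qed.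

(** The map u of middle terms kills Y, hence factors as h after [sc]; the lifted item is then pushed
    forward along [sc s] and is absorbed into [m]. *)
Lemma null_drop0 i Z Y (e : chain i Y) (l : list (item i Z)) :
  null (Item e (0 : hom Y Z) :: l) -> null l.
Proof.
elim: i Z Y e l => [|i IH] Z Y e l /=; first by rewrite comp0m add0r.
move=> [s [l' [m [ll' nl']]]]; move: nl'.
inversion ll' as [|? x ? k [u [v [-> uP vP]]] ll2]; subst.
rewrite /= compm0 in uP vP *.
have [h uh] := cokernel_desc (proj2 (sP (projT1 e))) uP.
have -> : v = sc s ∘ h.
  by apply: (ses_epi (sP (projT1 e))); rewrite vP uh compA.
move=> n; exists s, k, (Item (projT2 e) h :: m); split=> //=.
by apply: null_perm n; apply: Permutation_middle.
Qed.

(** Equality of classes is expressed as [null (l ++ neg l')]; this is the rule that makes it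
    transitive. Opposite items are merged into one with zero map and dropped. *)
Lemma null_cancel i Z (l l1 l2 : list (item i Z)) :
  null (l1 ++ l) -> null (l2 ++ neg l) -> null (l1 ++ l2).
Proof.
move=> n1 n2; have := null_app n1 n2; rewrite -!List.app_assoc.
move/(null_flat [:: l1; l; l2; neg l] [:: 0; 1; 2; 3] [:: 1; 3; 0; 2] isT).
rewrite /= List.app_assoc; move: (l1 ++ l2) => {n1 n2} {}l2.
elim: l => //= -[Y e h] l IH n; apply: IH.
apply: (@null_drop0 _ _ _ e); rewrite -(subrr h); apply: null_merge.
apply: null_perm n; apply: perm_skip; rewrite /pushi compNm comp1m -!List.app_assoc.
exact/Permutation_sym/Permutation_middle.
Qed.

Lemma null_nil i Z : null (nil : list (item i Z)).
Proof.
elim: i Z => [|i IH] Z //=; have [K K0] := has_zero Cab.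
exists (Ses (ses_to_zero Cab Z K0)), nil, nil; split; last exact: IH.
exact: Forall2_nil.
Qed.

Lemma null_sub i Z (l : list (item i Z)) : null (l ++ neg l).
Proof.
suff h (x : item i Z) : null (x :: neg (x :: nil)).
  elim: l => [|x l IH]; first exact: null_nil.
  apply: (null_perm _ (null_app (h x) IH)) => /=; apply: perm_skip.
  exact: Permutation_middle.
elim: i Z x {l} => [|i IH] Z [Y e h] /=.
  by rewrite compNm comp1m compNm addr0 subrr.
have [K K0] := has_zero Cab.
have [s [l' [u [v [ll' _ _]]]]] :=
  lift_exists (Ses (ses_to_zero Cab Z K0)) (Item e h :: nil).
have n0 := lift_neg ll'.
inversion ll' as [|? x ? k xP ll2]; subst; inversion ll2; subst.
exists s, (x :: neg (x :: nil)), nil; split; first exact: Forall2_cons.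
by rewrite List.app_nil_r; apply: IH.
Qed.

Lemma null_drop0s i Z Z' (l : list (item i Z)) (m : list (item i Z')) :
  null (l ++ push 0 m) -> null l.
Proof.
move/null_appC; elim: m => //= x m IH; rewrite /pushi comp0m.
by move/null_drop0.
Qed.

Lemma null_negP i Z (l : list (item i Z)) : null (neg l) -> null l.
Proof. by move/null_neg; rewrite neg_neg. Qed.

Lemma null_split i Z Y (e : chain i Y) (g g' : hom Y Z) (l : list (item i Z)) :
  null (Item e (g + g') :: l) -> null (Item e g :: Item e g' :: l).
Proof.
move=> n; apply: (@null_cancel _ _ (Item e (- (g + g')) :: nil)
  (Item e g :: Item e g' :: nil) l); last first.
  apply: (@null_appC _ _ (_ :: nil)).
  by rewrite /neg /= /pushi /= compNm comp1m opprK.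
have n1 := null_sub (Item e g :: nil); have n2 := null_sub (Item e g' :: nil).
have := null_app n1 n2; rewrite /neg /= /pushi /= !compNm !comp1m => n3.
have n4 : null (Item e (- g) :: Item e (- g') :: Item e g :: Item e g' :: nil).
  apply: null_perm n3.
  apply: (Permutation_trans (perm_swap _ _ _)); apply: perm_skip.
  apply: (@Permutation_trans _ _ (Item e g :: Item e (- g') :: Item e g' :: nil)).
    by apply: perm_skip; apply: perm_swap.
  exact: perm_swap.
have := null_merge n4; rewrite -opprD => n5.
by apply: null_perm n5; apply: (@Permutation_app_comm _ (_ :: nil)).
Qed.

(** Two maps of sequences over the same map on Y differ by a map that factors through the cokernel,
    so the two lifts differ by something coming from the middle term of [s]. *)
Lemma lift_unique i Z (s : ses Z) (l : list (item i.+1 Z)) l1 l2 :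
  lift s l l1 -> lift s l l2 -> exists m, null (l1 ++ neg (l2 ++ push (sc s) m)).
Proof.
move=> ll1; elim: ll1 l2 => [|x x1 {}l {}l1 xx1 ll1 IH] l2 ll2.
  by inversion ll2; subst; exists nil; apply: null_nil.
inversion ll2 as [|? x2 ? l2' xx2 ll2']; subst; move: xx1 xx2.
case: x {ll2} => Y [t e] h [u [v [-> uP vP]]] [u' [v' [-> uP' vP']]].
rewrite /= in u v u' v' uP vP uP' vP' *.
have [|d ud] := cokernel_desc (h := u - u') (proj2 (sP t)).
  by rewrite compBl uP uP' subrr.
have vE : v = v' + sc s ∘ d.
  by apply: (ses_epi (sP t)); rewrite compDl vP vP' -compA -ud compBr addrC subrK.
have [m nm] := IH l2' ll2'; exists (Item e d :: m).
have n : null (Item e v :: neg (Item e v' :: Item e (sc s ∘ d) :: nil)).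
  have := null_appC (null_sub (Item e v :: nil)).
  rewrite /neg /= /pushi /= !compNm !comp1m {1}vE opprD => /null_split n.
  exact: (null_flat [:: [:: _]; [:: _]; [:: _]] [:: 0; 1; 2] [:: 2; 0; 1] isT n).
have := null_app n nm; rewrite !neg_app.
exact: (null_flat [:: [:: _]; [:: _]; [:: _]; _; _; _]
  [:: 0; 1; 2; 3; 4; 5] [:: 0; 3; 1; 4; 2; 5] isT).
Qed.

(** Lift all items along one common sequence, add up the lifts by induction on the degree, and
    splice the resulting chain with that sequence. *)
Lemma single i Z (l : list (item i Z)) :
  exists w : chain i Z, null (Item w (idm Z) :: neg l).
Proof.
elim: i Z l => [|i IH] Z l.
  exists (sum0 l); rewrite /= comp1m.
  by have := sum0_neg l; rewrite /sum0 => ->; rewrite subrr.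
have [K K0] := has_zero Cab.
have [s [l' [_ [_ [ll' _ _]]]]] := lift_exists (Ses (ses_to_zero Cab Z K0)) l.
have [w nw] := IH _ l'.
exists (existT _ s w), s, (Item w (idm _) :: neg l'), nil; split.
  apply: Forall2_cons; last exact: lift_neg.
  by exists (idm _), (idm _); rewrite /= !compm1 !comp1m.
by rewrite List.app_nil_r.
Qed.

(** [null] provides a lift of its own choice; by uniqueness of lifts on a common enlargement, any
    prescribed lift comes from the middle term after enlarging. *)
Lemma null_lift i Z (s : ses Z) (l : list (item i.+1 Z)) l' :
  null l -> lift s l l' -> exists (s3 : ses Z) u v m,
    [/\ u ∘ sa s = sa s3, v ∘ sc s = sc s3 ∘ u
      & null (push v l' ++ push (sc s3) m)].
Proof.
move=> [t [k [m [lk nk]]]] ll'.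
have [s3 [u1 [v1 [u2 [v2 [e1 e2 e3 e4]]]]]] := ses_common t s (idm Z).
rewrite compm1 in e1.
have [m2 n2] := lift_unique (lift_enlarge e1 e2 lk) (lift_enlarge e3 e4 ll').
exists s3, u2, v2, (m2 ++ push u1 m); split=> //.
have n3 : null (push v1 (k ++ push (sc t) m)) := null_push v1 nk.
rewrite push_app push_push e2 in n3; have {}n3 := null_appC n3.
rewrite push_app push_push List.app_assoc; apply: null_appC.
apply: null_cancel n3 _; apply: null_negP.
by rewrite neg_app neg_neg; apply: null_appC n2.
Qed.

(* Exactness of Ext^i(X, A) -> Ext^i(X, B) -> Ext^i(X, K). *)
Lemma half_exact i A B K (a : hom A B) (c : hom B K) (l : list (item i B)) :
  short_exact a c -> null (push c l) ->
  exists m : list (item i A), null (push a m ++ neg l).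
Proof.
elim: i A B K a c l => [|i IH] A B K a c l ac.
  rewrite /= sum0_push => /(kernel_lift (proj1 ac))[f' fE].
  exists (@Item 0 A A f' (idm A) :: nil); rewrite /= sum0_neg fE compm1.
  by rewrite subrr.
move=> nl; have [O O0] := has_zero Cab.
have [s [l' [_ [_ [ll' _ _]]]]] := lift_exists (Ses (ses_to_zero Cab B O0)) l.
have mba : mono (sa s ∘ a).
  by apply: mono_comp; [apply: ses_mono (sP s)|apply: ses_mono ac].
(* With Q = [sB s] / A there is a short exact sequence K -> Q -> [sK s], so the same [l'] lifts both
   [l] along [s] and [push c l] along [sQ]. *)
have [Q [q baq]] := mono_ses Cab mba.
have [m [e [me mc eq]]] := ses_third Cab ac (sP s) baq.
pose sQ := Ses me.
have lQ : lift sQ (push c l) l'.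
  rewrite -[l']push_id; apply: lift_push ll'; first exact: esym mc.
  by rewrite comp1m -eq.
have [s3 [u [v [m0 [um vm n0]]]]] := null_lift nl lQ.
(* The vanishing of [v l' + sc s3 m0] says that the pair ([l'], [m0]) dies under the second map of Q
   -> [sK s] (+) [sB s3] -> [sK s3]. By induction it comes from Q, and its first component gives a
   preimage of [l'] along e. *)
have [P [i1 [i2 [p1 [p2 bip]]]]] := has_biproduct Cab (sK s) (sB s3).
have cone := ses_cone Cab me (sP s3) um vm bip.
have [p1i1 p2i2 p2i1 p1i2 _] := bip.
have [|th nth] := IH _ _ _ _ _ (push i1 l' ++ push i2 m0) cone.
  rewrite push_app !push_push !compDl -!(compA _ p1) -!(compA _ p2).
  by rewrite p1i1 p2i2 p2i1 p1i2 !compm1 !compm0 addr0 add0r.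
have {nth} : null (push e th ++ neg l').
  move/(null_push p1): nth; rewrite push_app push_push push_neg push_app.
  rewrite !push_push compBr !compA p1i1 p1i2 comp1m comp0m subr0 push_id.
  by rewrite neg_app List.app_assoc /neg push_push compm0; apply: null_drop0s.
have [w nw] := single th => nth.
have nw' : null (Item w e :: neg l').
  move/(null_push e): nw; rewrite [push _ _]/= /pushi compm1.
  rewrite -/(push e (neg th)) push_neg => nw.
  apply: (@null_cancel _ _ (neg (push e th)) (Item w e :: nil)) => //.
  by rewrite neg_neg; apply: null_appC.
(* Splicing the class w over Q with A -> [sB s] -> Q gives the element of Ext^(i+1)(X, A). *)
exists (@Item i.+1 A A (existT _ (Ses baq) w) (idm A) :: nil).
exists s, (Item w e :: neg l'), nil; split; last by rewrite List.app_nil_r.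
apply: Forall2_cons; last exact: lift_neg.
by exists (idm _), e; rewrite /= !compm1 !comp1m -eq.
Qed.

(* Exactness at Ext^i(X, K), the connecting map being splicing with (a, c). *)
Lemma connecting_exact i A (s : ses A) (w : chain i (sK s)) :
  null (@Item i.+1 A A (existT _ s w) (idm A) :: nil) ->
  exists m, null (push (sc s) m ++ neg (Item w (idm _) :: nil)).
Proof.
move=> n; have ls : lift s (@Item i.+1 A A (existT _ s w) (idm A) :: nil)
    (Item w (idm _) :: nil).
  apply: Forall2_cons; last exact: Forall2_nil.
  by exists (idm _), (idm _); rewrite /= !compm1 !comp1m.
have [s3 [u [v [m0 [um vm n0]]]]] := null_lift n ls.
(* The same device, with the cone [sB s] -> [sK s] (+) [sB s3] -> [sK s3]: w together with [m0]
   comes from [sB s]. *)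
have [P [i1 [i2 [p1 [p2 bip]]]]] := has_biproduct Cab (sK s) (sB s3).
have cone := ses_cone Cab (sP s) (sP s3) um vm bip.
have [p1i1 p2i2 p2i1 p1i2 _] := bip.
have [|m nm] := half_exact (l := push i1 (Item w (idm _) :: nil) ++ push i2 m0) cone.
  rewrite push_app !push_push !compDl -!(compA _ p1) -!(compA _ p2).
  by rewrite p1i1 p2i2 p2i1 p1i2 !compm1 !compm0 addr0 add0r.
exists m; move/(null_push p1): nm; rewrite push_app push_push push_neg push_app.
rewrite !push_push compBr !compA p1i1 p1i2 comp1m comp0m subr0 push_id.
by rewrite neg_app List.app_assoc /neg push_push compm0; apply: null_drop0s.
Qed.

(** The remaining exactness, at Ext^(i+1)(X, A): the kernel of the map to Ext^(i+1)(X, B) is the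
    image of the connecting map, which is zero once Ext^i(X, B) -> Ext^i(X, K) is onto. *)
Lemma inj_exact i A B K (a : hom A B) (c : hom B K) (l : list (item i.+1 A)) :
  short_exact a c ->
  (forall m : list (item i K), exists m', null (push c m' ++ neg m)) ->
  null (push a l) -> null l.
Proof.
move=> ac surj [s [l' [m0 [ll' n0]]]].
have mba : mono (sa s ∘ a).
  by apply: mono_comp; [apply: ses_mono (sP s)|apply: ses_mono ac].
have [Q [q baq]] := mono_ses Cab mba.
have [m [e [me mc eq]]] := ses_third Cab ac (sP s) baq.
pose sQ := Ses baq.
(* The maps of middle terms used to lift [push a l] along [s] also lift [l] along A -> [sB s] -> Q,
   and e takes the new lift to the old one. *)
have [lQ [llQ el]] : exists lQ, lift sQ l lQ /\ push e lQ = l'.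
  move: {n0} l' ll'; elim: l => [|x l IH] l' ll'; inversion ll'; subst.
    by exists nil; split=> //; apply: Forall2_nil.
  have [lQ [llQ <-]] := IH _ H3; case: H1 => [u [v [-> /= uP vP]]].
  have [|v' v'P] := @ses_desc _ _ (projT1 (iel x)) sQ (ih x) u.
    by rewrite uP /= compA.
  exists (Item (projT2 (iel x)) v' :: lQ); split.
    by apply: Forall2_cons => //; exists u, v'; rewrite uP /= compA.
  rewrite /push /= /pushi; congr (Item _ _ :: _).
  by apply: (ses_epi (sP (projT1 (iel x)))); rewrite -compA v'P vP /= compA eq.
have [|m2 n2] := half_exact (l := push q m0 ++ lQ) me.
  by rewrite push_app push_push eq el; apply: null_appC.
(* [m2] over K is the obstruction to [lQ] coming from [sB s]; written as c [m3], it becomes q (sa s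
   [m3]) in Q and is cancelled. *)
have [m3 n3] := surj m2.
have n4 : null (push m (push c m3 ++ neg m2)) := null_push m n3.
rewrite push_app push_neg push_push mc in n4.
have := null_neg (null_cancel (null_appC n2) n4); rewrite neg_app neg_neg.
exists sQ, lQ, (m0 ++ neg (push (sa s) m3)); split=> //.
rewrite /= push_app push_neg push_push.
move: H; rewrite -List.app_assoc.
exact: (null_flat [:: _; _; _] [:: 0; 1; 2] [:: 1; 0; 2] isT).
Qed.

(** * Vanishing and dimension shifting *)

Definition Ext_null i Z := forall l : list (item i Z), null l.

Lemma Ext_null_iso i Y Z : isomorphic Y Z -> Ext_null i Y -> Ext_null i Z.
Proof.
move=> [f [g [_ fg]]] nY l; rewrite -[l]push_id -fg -push_push.
exact/null_push/nY.
Qed.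

Lemma Ext_null_cokernel i A B K (a : hom A B) (c : hom B K) : short_exact a c ->
  Ext_null i B -> Ext_null i.+1 A -> Ext_null i K.
Proof.
move=> ac nB nA l; have [w nw] := single l.
have [m nm] := @connecting_exact _ _ (Ses ac) w (nA _).
have n1 := null_cancel (@null_appC _ _ (_ :: nil) _ nw) nm.
apply: null_negP; rewrite -[neg l]List.app_nil_r.
apply: (null_cancel n1); exact/null_neg/null_push/nB.
Qed.

Lemma Ext_null_kernel i A B K (a : hom A B) (c : hom B K) : short_exact a c ->
  Ext_null i K -> Ext_null i.+1 B -> Ext_null i.+1 A.
Proof.
move=> ac nK nB l; apply: (inj_exact ac) => // m; exists nil.
exact: nK.
Qed.

Lemma Ext1_null_kernel A B K (a : hom A B) (c : hom B K) : short_exact a c ->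
  (forall f : hom X K, exists g, f = c ∘ g) -> Ext_null 1 B -> Ext_null 1 A.
Proof.
move=> ac surj nB l; apply: (inj_exact ac) => // m.
have [g gE] := surj (sum0 m); exists (@Item 0 B B g (idm B) :: nil).
by rewrite /= sum0_neg gE compm1 subrr.
Qed.

Lemma Ext1_null_lift A B K (a : hom A B) (c : hom B K) (f : hom X K) :
  short_exact a c -> Ext_null 1 A -> exists g, f = c ∘ g.
Proof.
move=> ac nA.
have [m nm] := @connecting_exact 0 _ (Ses ac) f (nA _).
have : sum0 (push c m ++ neg (@Item 0 K K f (idm K) :: nil)) = 0 := nm.
rewrite sum0_app sum0_neg sum0_push /= addr0 comp1m => /eqP.
by rewrite subr_eq0 => /eqP <-; exists (sum0 m).
Qed.

Lemma Hom_nullP Y : Ext_null 0 Y <-> forall f : hom X Y, f = 0.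
Proof.
split=> [nY f|Y0 l]; last exact: Y0.
by have := nY (@Item 0 Y Y f (idm Y) :: nil); rewrite /= addr0 comp1m.
Qed.

End ExtSums.

(** * Comparison with Yoneda extensions *)

Arguments ext_mono {C n X Y} e [W g h] _.
Arguments ext_epi {C n X Y} e [Z g h] _.

Section Yoneda.
Local Open Scope ring_scope.
Import GRing.Theory.
Variable C : preadditive.
Hypothesis Cab : abelian C.
Implicit Types A B E K P Q W Y Z : C.

Lemma ses_iso_left A A' B K (j : hom A' A) (a : hom A B) (c : hom B K) :
  is_iso j -> short_exact a c -> short_exact (a ∘ j) c.
Proof.
move=> jiso ac; apply: (mono_cokernel_ses Cab).
  by apply: mono_comp; [apply: ses_mono ac|apply: iso_mono].
apply: cokernelP; first exact: ses_epi ac.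
  by rewrite compA (ses_comp0 ac) comp0m.
move=> W h; rewrite compA => /(epi_eq0 (iso_epi jiso)).
exact: (cokernel_desc (proj2 ac)).
Qed.

Lemma ses_iso_right A B K K' (a : hom A B) (c : hom B K) (j : hom K K') :
  is_iso j -> short_exact a c -> short_exact a (j ∘ c).
Proof.
move=> jiso ac; apply: (epi_kernel_ses Cab).
  by apply: epi_comp; [apply: iso_epi|apply: ses_epi ac].
apply: kernelP; first exact: ses_mono ac.
  by rewrite -compA (ses_comp0 ac) compm0.
move=> W h; rewrite -compA => /(mono_eq0 (iso_mono jiso)).
exact: (kernel_lift (proj1 ac)).
Qed.

Lemma ses_pullback Y B K X (a : hom Y B) (c : hom B K) (f : hom X K) :
  short_exact a c -> exists P (a' : hom Y P) (c' : hom P X) (u : hom P B),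
    [/\ short_exact a' c', c ∘ u = f ∘ c' & u ∘ a' = a].
Proof.
move=> [ca ac].
have [P [c' [a' [u [[s1 s2] e1 e2]]]]] :=
  @ses_pushout (op C) (abelian_op Cab) K B Y X c a f (conj ac ca).
by exists P, a', c', u.
Qed.

Lemma exact_epi_left A A' B D (e : hom A' A) (f : hom A B) (g : hom B D) :
  epi e -> exact (f ∘ e) g <-> exact f g.
Proof.
move=> ee; suff h Q (c : hom B Q) : is_cokernel (f ∘ e) c <-> is_cokernel f c.
  by split=> -[J [m [[Q [c [fc cm]]] gm]]]; exists J, m; split=> //;
    exists Q, c; split=> //; apply/h.
split=> fc; apply: cokernelP; try exact: cokernel_epi fc.
- by apply: (epi_eq0 ee); rewrite -compA (proj1 fc).
- by move=> W h hf; apply: (cokernel_desc fc); rewrite compA hf comp0m.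
- by rewrite compA (proj1 fc) comp0m.
- by move=> W h; rewrite compA => /(epi_eq0 ee); apply: (cokernel_desc fc).
Qed.

Lemma ses_exact_mono A B K D (a : hom A B) (c : hom B K) (m : hom K D) :
  short_exact a c -> mono m -> exact a (m ∘ c).
Proof.
move=> ac mm; exists A, a; split.
  by exists K, c; split; [apply: (proj2 ac)|apply: (proj1 ac)].
apply: kernelP; first exact: ses_mono ac.
  by rewrite -compA (ses_comp0 ac) compm0.
move=> W h; rewrite -compA => /(mono_eq0 mm).
exact: (kernel_lift (proj1 ac)).
Qed.

Lemma exact_mono_factor A B D (a : hom A B) (d : hom B D) :
  mono a -> exact a d -> exists K (p : hom B K) (m : hom K D),
    [/\ short_exact a p, mono m & d = m ∘ p].
Proof.
move=> ma [J [n [[Q [c [ac cn]]] dn]]].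
have [e ae] := kernel_lift cn (proj1 ac).
have da0 : d ∘ a = 0 by rewrite ae compA (proj1 dn) comp0m.
have [m dm] := cokernel_desc ac da0.
exists Q, c, m; split=> //; first exact: mono_cokernel_ses.
apply: mono0 => W x mx.
have [V [w [y [ew xw]]]] := epi_lift Cab x (cokernel_epi ac).
have dy0 : d ∘ y = 0 by rewrite dm -compA -xw compA mx comp0m.
have [z yz] := kernel_lift dn dy0.
by apply: (epi_eq0 ew); rewrite xw yz compA (proj1 cn) comp0m.
Qed.

(** * Morphisms, cutting and splicing of extensions *)

Variable X : C.

(** A morphism of extensions over an arbitrary map at the Y end: cutting off the first sequence
    changes that end, so inductions need this generality. *)
Definition ext_map n Y Y' (E : extension n X Y) (E' : extension n X Y')
    (y : hom Y Y') : Prop :=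
  exists phi : forall i, hom (E i) (E' i),
    [/\ forall i, (i <= n)%N -> phi i.+1 ∘ diff E i = diff E' i ∘ phi i,
        phi 0%N ∘ ext_in E = ext_in E' ∘ y
      & ext_out E' ∘ phi n.+1 = ext_out E].

Lemma ext_mapP n Y (E E' : extension n X Y) :
  ext_morphism E E' <-> ext_map E E' (idm Y).
Proof. by split=> -[phi [h1 h2 h3]]; exists phi; split; rewrite ?compm1 // h2 compm1. Qed.

Lemma ext_map_comp n Y Y' Y'' (E : extension n X Y) (E' : extension n X Y')
    (E'' : extension n X Y'') (y : hom Y Y') (y' : hom Y' Y'') :
  ext_map E E' y -> ext_map E' E'' y' -> ext_map E E'' (y' ∘ y).
Proof.
move=> [phi [h1 h2 h3]] [psi [k1 k2 k3]]; exists (fun i => psi i ∘ phi i).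
split=> [i le_in||].
- by rewrite -compA h1 // compA k1 // compA.
- by rewrite -compA h2 compA k2 compA.
- by rewrite compA k3 h3.
Qed.

(** A way to cut E at the cokernel of its first map. Working with any such data, rather than a fixed
    choice, lets the cut of a splice be compared with its original pieces. *)
Record tail_data n Y (E : extension n.+1 X Y) := TailData {
  tdK : C; tdp : hom (E 1%N) tdK; tdm : hom tdK (E 2%N);
  td_ses : short_exact (diff E 0 ∘ ext_in E) tdp;
  td_mono : mono tdm;
  td_diff : diff E 1 = tdm ∘ tdp }.

Arguments td_mono {n Y E} t [W g h] _.

Lemma tail_data_ex n Y (E : extension n.+1 X Y) : exists _ : tail_data E, True.
Proof.
have [K [p [m [s mm dm]]]] := exact_mono_factor (ext_mono E) (ext_exact E (ltn0Sn n)).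
by exists (TailData (ses_iso_left (ext_in_iso E) s) mm dm).
Qed.

Definition tail_choice n Y (E : extension n.+1 X Y) : tail_data E :=
  proj1_sig (constructive_indefinite_description _ (tail_data_ex E)).

Section Tail.
Variables (n : nat) (Y : C) (E : extension n.+1 X Y) (d : tail_data E).

Definition tail_seq : sequence C :=
  @Sequence C (fun i => if i is j.+1 then E j.+2 else tdK d)
    (fun i => match i with 0%N => tdm d | j.+1 => diff E j.+2 end).

Lemma tail_exact i : (i < n)%N -> exact (diff tail_seq i) (diff tail_seq i.+1).
Proof.
case: i => [|i] lt_in; last exact: ext_exact.
rewrite /= -(exact_epi_left _ _ (ses_epi (td_ses d))) -td_diff.
exact: (ext_exact E (i := 1)).
Qed.

Lemma tail_epi : epi (diff tail_seq n).
Proof.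
rewrite /tail_seq; case: n E d => [|k] E' d'; last exact: ext_epi E'.
by apply: (@epi_compl _ _ _ _ _ (tdp d')); rewrite -td_diff; apply: ext_epi E'.
Qed.

Definition tail : extension n X (tdK d) :=
  @Extension C n X (tdK d) tail_seq (idm (tdK d)) (ext_out E)
    (iso_id (tdK d)) (ext_out_iso E) (td_mono d) tail_exact tail_epi.

End Tail.

Section Splice.
Variables (n : nat) (Y : C) (s : ses Y) (F : extension n X (sK s)).

Definition splice_seq : sequence C :=
  @Sequence C (fun i => match i with 0%N => Y | 1%N => sB s | j.+2 => F j.+1 end)
    (fun i => match i with
              | 0%N => sa s
              | 1%N => diff F 0 ∘ ext_in F ∘ sc s
              | j.+2 => diff F j.+1 end).

Let mono_d0 : mono (diff F 0 ∘ ext_in F).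
Proof. by apply: mono_comp; [apply: ext_mono|apply: iso_mono (ext_in_iso F)]. Qed.

Let epi_in : epi (ext_in F ∘ sc s).
Proof. by apply: epi_comp; [apply: iso_epi (ext_in_iso F)|apply: ses_epi (sP s)]. Qed.

Lemma splice_exact i :
  (i < n.+1)%N -> exact (diff splice_seq i) (diff splice_seq i.+1).
Proof.
case: i => [|[|i]] lt_in; last exact: ext_exact.
  exact: ses_exact_mono (sP s) mono_d0.
by rewrite /= -compA exact_epi_left //; apply: ext_exact.
Qed.

Lemma splice_epi : epi (diff splice_seq n.+1).
Proof.
rewrite /splice_seq; move: (epi_in); case: n F => [|k] F' ein; last exact: ext_epi F'.
by rewrite /= -compA; apply: epi_comp => //; apply: ext_epi F'.
Qed.

Definition splice : extension n.+1 X Y :=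
  @Extension C n.+1 X Y splice_seq (idm Y) (ext_out F) (iso_id Y) (ext_out_iso F)
    (ses_mono (sP s)) splice_exact splice_epi.

End Splice.

Lemma tail_map n Y Y' (E : extension n.+1 X Y) (E' : extension n.+1 X Y')
    (d : tail_data E) (d' : tail_data E') (y : hom Y Y') : ext_map E E' y ->
  exists u v, [/\ u ∘ sa (Ses (td_ses d)) = sa (Ses (td_ses d')) ∘ y,
    v ∘ sc (Ses (td_ses d)) = sc (Ses (td_ses d')) ∘ u
    & ext_map (tail d) (tail d') v].
Proof.
move=> [phi [h1 h2 h3]].
have uP : phi 1%N ∘ sa (Ses (td_ses d)) = sa (Ses (td_ses d')) ∘ y.
  by rewrite /= compA h1 // -compA h2 compA.
have [v vP] := @ses_desc _ _ _ (Ses (td_ses d)) (Ses (td_ses d')) y (phi 1%N) uP.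
exists (phi 1%N), v; split=> //.
exists (fun i => if i is j.+1 return hom (tail_seq d i) (tail_seq d' i)
                 then phi j.+2 else v).
split=> //=; last by rewrite compm1 comp1m.
case=> [|i] le_in /=; last exact: h1.
apply: (ses_epi (td_ses d)); rewrite -!compA vP /= -(td_diff d) h1 // (td_diff d').
by rewrite !compA.
Qed.

Lemma splice_map n Y Y' (s : ses Y) (s' : ses Y') (F : extension n X (sK s))
    (F' : extension n X (sK s')) y u v :
  u ∘ sa s = sa s' ∘ y -> v ∘ sc s = sc s' ∘ u -> ext_map F F' v ->
  ext_map (splice F) (splice F') y.
Proof.
move=> us vs [phi [h1 h2 h3]].
exists (fun i => match i return hom (splice_seq F i) (splice_seq F' i) with
  | 0%N => y | 1%N => u | j.+2 => phi j.+1 end).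
split=> //=; last by rewrite compm1 comp1m.
case=> [|[|i]] le_in //=; last exact: h1.
by rewrite !compA h1 // -!compA -vs !compA -(compA _ (phi 0%N)) h2 compA.
Qed.

Lemma splice_tail n Y (E : extension n.+1 X Y) (d : tail_data E) :
  ext_map E (@splice _ _ (Ses (td_ses d)) (tail d)) (idm Y).
Proof.
have [j [jin inj]] := ext_in_iso E.
exists (fun i => match i return hom (E i) (splice_seq (s := Ses (td_ses d)) (tail d) i) with
  | 0%N => j | 1%N => idm _ | k.+2 => idm _ end).
split=> /=; rewrite ?compm1 //.
case=> [|[|i]] le_in /=.
- by rewrite -compA inj comp1m compm1.
- by rewrite !compm1 comp1m (td_diff d).
- by rewrite compm1 comp1m.
Qed.

Lemma tail_splice n Y (s : ses Y) (F : extension n X (sK s))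
    (d : tail_data (splice F)) :
  exists v, v ∘ tdp d = sc s /\ ext_map (tail d) F v.
Proof.
have [|v vP] := @ses_desc _ _ _ (Ses (td_ses d)) s (idm Y) (idm (sB s)).
  by rewrite /= !compm1 comp1m.
have {}vP : v ∘ tdp d = sc s by rewrite -[RHS]compm1.
exists v; split=> //.
exists (fun i => match i return hom (tail_seq d i) (F i) with
  | 0%N => ext_in F ∘ v | j.+1 => idm _ end).
split=> //=; rewrite ?compm1 //.
case=> [|i] le_in /=; last by rewrite compm1 comp1m.
apply: (ses_epi (td_ses d)); rewrite comp1m -td_diff /=.
by rewrite -!compA vP.
Qed.

Lemma ext_push n Y Z (E : extension n.+1 X Y) (g : hom Y Z) :
  exists F : extension n.+1 X Z, ext_map E F g.
Proof.
have d := tail_choice E.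
have [B' [a' [c' [u [ac ua cu]]]]] := ses_pushout Cab g (td_ses d).
exists (@splice _ _ (Ses ac) (tail d)); rewrite -[g]compm1.
apply: ext_map_comp (splice_tail d) _.
apply: (@splice_map n Y Z (Ses (td_ses d)) (Ses ac) (tail d) (tail d) g u (idm _)).
- exact: ua.
- by rewrite comp1m.
exists (fun i => idm _); split; rewrite ?compm1 ?comp1m // => i _.
by rewrite compm1 comp1m.
Qed.

(** A 0-extension amounts to an isomorphism Y -> X; its inverse is the element of Hom(X, Y) with
    which [chain_of] ends. *)
Lemma ext0_iso Y (E : extension 0 X Y) :
  exists f, f ∘ (ext_out E ∘ diff E 0 ∘ ext_in E) = idm Y /\
            (ext_out E ∘ diff E 0 ∘ ext_in E) ∘ f = idm X.
Proof.
apply: iso_comp (ext_in_iso E); apply: iso_comp (ext_out_iso E) _.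
by apply: (mono_epi_iso Cab); [apply: ext_mono|apply: ext_epi].
Qed.

(** * From Yoneda extensions to chains and back *)

Fixpoint chain_of n : forall Y, extension n X Y -> chain X n Y :=
  match n with
  | 0%N => fun Y (E : extension 0 X Y) =>
      proj1_sig (constructive_indefinite_description _ (ext0_iso E))
  | k.+1 => fun Y (E : extension k.+1 X Y) =>
      existT _ (Ses (td_ses (tail_choice E))) (chain_of (tail (tail_choice E)))
  end.

Fixpoint chain_map n : forall Y Y', chain X n Y -> chain X n Y' -> hom Y Y' -> Prop :=
  match n with
  | 0%N => fun Y Y' e e' y => y ∘ e = e'
  | k.+1 => fun Y Y' e e' y => exists u v,
      [/\ u ∘ sa (projT1 e) = sa (projT1 e') ∘ y,
          v ∘ sc (projT1 e) = sc (projT1 e') ∘ u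
        & chain_map (projT2 e) (projT2 e') v]
  end.

Lemma chain_map_comp n Y Y' Y'' (e : chain X n Y) (e' : chain X n Y')
    (e'' : chain X n Y'') (y : hom Y Y') (y' : hom Y' Y'') :
  chain_map e e' y -> chain_map e' e'' y' -> chain_map e e'' (y' ∘ y).
Proof.
elim: n Y Y' Y'' e e' e'' y y' => [|n IH] Y Y' Y'' e e' e'' y y' /=.
  by move=> <- <-; rewrite compA.
move=> [u [v [h1 h2 h3]]] [u' [v' [k1 k2 k3]]].
exists (u' ∘ u), (v' ∘ v); split; last exact: IH h3 k3.
  by rewrite -compA h1 compA k1 compA.
by rewrite -compA h2 compA k2 compA.
Qed.

Lemma ext_map_chain n Y Y' (E : extension n X Y) (E' : extension n X Y') y :
  ext_map E E' y -> chain_map (chain_of E) (chain_of E') y.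
Proof.
elim: n Y Y' E E' y => [|n IH] Y Y' E E' y /=; last first.
  move=> /(tail_map (tail_choice E) (tail_choice E'))[u [v [us vs /IH t]]].
  by exists u, v.
move=> [phi [h1 h2 h3]].
case: constructive_indefinite_description => f /= [fE Ef].
case: constructive_indefinite_description => f' /= [fE' Ef'].
set e := _ ∘ ext_in E in fE Ef; set e' := _ ∘ ext_in E' in fE' Ef'.
have ee' : e' ∘ y = e.
  by rewrite /e' -compA -h2 compA -(compA _ (diff E' 0)) -h1 // compA h3.
by rewrite -[y]comp1m -fE' -(compA f') ee' -compA Ef compm1.
Qed.

Lemma chain_map_null n Y Y' (e : chain X n Y) (e' : chain X n Y') y :
  chain_map e e' y -> null (Item e y :: neg (Item e' (idm Y') :: nil)).
Proof.
elim: n Y Y' e e' y => [|n IH] Y Y' e e' y.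
  by move=> /= ->; rewrite compm1 compNm comp1m addr0 subrr.
move=> [u [v [us vs /IH n0]]].
exists (projT1 e'), (Item (projT2 e) v :: neg (Item (projT2 e') (idm _) :: nil)), nil.
split; last by rewrite List.app_nil_r.
apply: Forall2_cons; first by exists u, v.
apply: lift_neg; apply: Forall2_cons; last exact: Forall2_nil.
by exists (idm _), (idm _); rewrite !compm1 !comp1m.
Qed.

Definition eqx n Y (e e' : chain X n Y) :=
  null (Item e (idm Y) :: neg (Item e' (idm Y) :: nil)).

Lemma eqx_refl n Y (e : chain X n Y) : eqx e e.
Proof. exact: (null_sub Cab (_ :: nil)). Qed.

Lemma eqx_sym n Y (e e' : chain X n Y) : eqx e e' -> eqx e' e.
Proof.
rewrite /eqx => /(null_neg Cab); rewrite /neg /= /pushi /= !compNm !comp1m opprK.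
exact/null_perm/perm_swap.
Qed.

Lemma eqx_trans n Y (e e' e'' : chain X n Y) : eqx e e' -> eqx e' e'' -> eqx e e''.
Proof.
move=> /eqx_sym e1 /eqx_sym e2.
apply: eqx_sym; apply: (null_cancel Cab (l := neg (Item e' (idm Y) :: nil))
  (l1 := Item e'' (idm Y) :: nil) (l2 := neg (Item e (idm Y) :: nil))) => //.
by rewrite -neg_app; apply: (null_neg Cab); apply: eqx_sym.
Qed.

Lemma yoneda_eqx n Y (E E' : extension n X Y) :
  yoneda_eq E E' -> eqx (chain_of E) (chain_of E').
Proof.
elim=> {E E'} [E E' /ext_mapP /ext_map_chain|E|E E' _|E E' E'' _ + _].
- exact: chain_map_null.
- exact: eqx_refl.
- exact: eqx_sym.
- exact: eqx_trans.
Qed.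

Definition ext_id : extension 0 X X.
Proof.
apply: (@Extension C 0 X X (@Sequence C (fun _ => X) (fun _ => idm X))
  (idm X) (idm X)) => //=.
- exact: iso_id.
- exact: iso_id.
- exact/iso_mono/iso_id.
- exact/iso_epi/iso_id.
Defined.

Lemma chain_of_splice n Y (s : ses Y) (F : extension n X (sK s)) (e : chain X n (sK s)) :
  chain_map (chain_of F) e (idm _) ->
  chain_map (chain_of (splice F)) (existT _ s e : chain X n.+1 Y) (idm Y).
Proof.
move=> Fe; have [v [vP /ext_map_chain vF]] := tail_splice (tail_choice (splice F)).
exists (idm _), v; split=> //=; rewrite ?compm1 ?comp1m //.
by rewrite -[v]comp1m; apply: chain_map_comp Fe.
Qed.

(** The degree is positive so that the final map X -> K of a chain can be absorbed, by pulling the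
    last short exact sequence back along it. *)
Lemma ext_of_chain n Y (e : chain X n.+1 Y) :
  exists E : extension n.+1 X Y, chain_map (chain_of E) e (idm Y).
Proof.
elim: n Y e => [|n IH] Y [s e]; last first.
  by have [F Fe] := IH _ e; exists (splice F); apply: chain_of_splice.
have [P [a [c [u [ac cu ua]]]]] := ses_pullback e (sP s).
exists (@splice _ _ (Ses ac) ext_id); rewrite -[idm Y]comp1m.
apply: chain_map_comp (@chain_of_splice 0 _ (Ses ac) ext_id (idm X) _) _.
  rewrite /=; case: constructive_indefinite_description => f /= [].
  by rewrite !compm1 => ->; rewrite compm1.
by exists u, e; rewrite /= !compm1.
Qed.

Lemma Ext_zero_null n Y : Ext_zero n X Y -> Ext_null X n Y.
Proof.
case: n => [|n]; first by move/Hom_nullP.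
move=> E0 l; have [w nw] := single Cab l.
(* [w0] represents zero; realising [w] and [w0] by extensions makes the two classes equal. *)
have [w0 nw0] := single Cab (nil : list (item X n.+1 Y)).
have [E Ew] := ext_of_chain w; have [F Fw] := ext_of_chain w0.
have ww0 : eqx w w0.
  apply: eqx_trans (chain_map_null Fw); apply: eqx_trans (yoneda_eqx (E0 E F)).
  exact/eqx_sym/chain_map_null.
have nw1 : null (Item w (idm Y) :: nil).
  rewrite -[_ :: nil]List.app_nil_r.
  apply: (null_cancel Cab (l := neg (Item w0 (idm Y) :: nil))
    (l1 := Item w (idm Y) :: nil)) => //.
  by rewrite neg_neg.
apply: (null_negP Cab); rewrite -[neg l]List.app_nil_r.
apply: (null_cancel Cab (l := Item w (idm Y) :: nil)).
  exact: (@null_appC _ _ _ _ (_ :: nil) _ nw).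
exact: (null_neg Cab nw1).
Qed.

Lemma ext1_ses Y (E : extension 1 X Y) :
  short_exact (diff E 0 ∘ ext_in E) (ext_out E ∘ diff E 1).
Proof.
have [d _] := tail_data_ex E; rewrite (td_diff d) compA.
apply: ses_iso_right (td_ses d); apply: iso_comp (ext_out_iso E) _.
apply: (mono_epi_iso Cab); first exact: td_mono.
by apply: (@epi_compl _ _ _ _ _ (tdp d)); rewrite -(td_diff d); apply: ext_epi E.
Qed.

Lemma Ext1_null_zero Y : Ext_null X 1 Y -> Ext_zero 1 X Y.
Proof.
move=> nY E E'; apply: rst_step; apply/ext_mapP.
have [s sE] := Ext1_null_lift Cab (idm X) (ext1_ses E) nY.
have [s' sE'] := Ext1_null_lift Cab (idm X) (ext1_ses E') nY.
have := ext1_ses E; have := ext1_ses E'; move: sE sE'.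
set d := _ ∘ ext_in E; set p := _ ∘ diff E 1.
set d' := _ ∘ ext_in E'; set p' := _ ∘ diff E' 1 => sE sE' dp' dp.
(* r is the retraction belonging to the section s of p. *)
have [|r rP] := kernel_lift (h := idm _ - s ∘ p) (proj1 dp).
  by rewrite compBr compm1 compA -sE comp1m subrr.
have rd : r ∘ d = idm Y.
  apply: (ses_mono dp); rewrite compA -rP compBl comp1m -compA (ses_comp0 dp).
  by rewrite compm0 subr0 compm1.
have [j [jin inj]] := ext_in_iso E; have [o [oout outo]] := ext_out_iso E'.
(* The middle component maps E 1 = Y (+) X to E' 1 summand by summand; indices above 2 are out of
   range. *)
pose phi i : hom (E i) (E' i) := match i return hom (E i) (E' i) with
  | 0%N => ext_in E' ∘ j | 1%N => d' ∘ r + s' ∘ p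
  | 2%N => o ∘ ext_out E | _ => 0 end.
exists phi; split=> /=; last by rewrite compA outo comp1m.
  case=> [|[|//]] _ /=.
    have phid : (d' ∘ r + s' ∘ p) ∘ d = d'.
      by rewrite compDl -(compA d') -(compA s') (ses_comp0 dp) compm0 addr0 rd compm1.
    rewrite -[diff E 0]compm1 -inj (compA (diff E 0)) -/d (compA _ d) phid.
    by rewrite compA.
  have p'phi : p' ∘ (d' ∘ r + s' ∘ p) = p.
    by rewrite compDr (compA p' d') (ses_comp0 dp') comp0m add0r (compA p' s') -sE' comp1m.
  by rewrite -[diff E' 1]comp1m -oout -(compA o (ext_out E')) -/p' -(compA o p') p'phi compA.
by rewrite -compA jin ?compm1.
Qed.

Lemma yoneda_splice n Y (s : ses Y) (F F' : extension n X (sK s)) :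
  yoneda_eq F F' -> yoneda_eq (splice F) (splice F').
Proof.
elim=> {F F'} [F F' /ext_mapP FF'|F|F F' _|F F' F'' _ + _].
- apply: rst_step; apply/ext_mapP.
  by apply: (@splice_map _ _ _ _ _ _ _ _ (idm _) _ _ _ FF'); rewrite ?compm1 ?comp1m.
- exact: rst_refl.
- exact: rst_sym.
- exact: rst_trans.
Qed.

(* Dimension shifting for Yoneda classes: enlarge the middle term of the first
   short exact sequence until the remaining Ext vanishes. *)
Lemma Ext_zero_shift n Y :
  (forall D (a : hom Y D), mono a -> exists (s : ses Y) (u : hom D (sB s)),
     u ∘ a = sa s /\ Ext_zero n.+1 X (sK s)) ->
  Ext_zero n.+2 X Y.
Proof.
move=> shift E E'; pose d := tail_choice E; pose d' := tail_choice E'.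
have [s3 [u1 [v1 [u2 [v2 [e1 e2 e3 e4]]]]]] :=
  ses_common Cab (Ses (td_ses d)) (Ses (td_ses d')) (idm Y).
have [s [u [us E0]]] := shift _ _ (ses_mono (sP s3)).
have us1 : u ∘ sa s3 = sa s ∘ idm Y by rewrite compm1.
have [v vP] := ses_desc us1.
(* Every extension whose first sequence maps to [s3] maps to a splice over the common sequence [s];
   applied to both E and E'. *)
have key (G : extension n.+2 X Y) (t : tail_data G) w x :
    w ∘ sa (Ses (td_ses t)) = sa s3 -> x ∘ tdp t = sc s3 ∘ w ->
  exists F : extension n.+1 X (sK s), ext_morphism G (splice F).
  move=> wP xP; have [F tF] := ext_push (tail t) (v ∘ x).
  exists F; apply/ext_mapP; rewrite -[idm Y]comp1m.
  apply: ext_map_comp (splice_tail t) _.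
  apply: (splice_map (u := u ∘ w) _ _ tF).
    by rewrite -compA wP us compm1.
  by rewrite -!compA xP !compA vP.
rewrite compm1 in e1.
have [F EF] := key _ d _ _ e1 e2; have [F' EF'] := key _ d' _ _ e3 e4.
apply: (rst_trans _ _ _ (splice F)); first exact: rst_step.
apply: (rst_trans _ _ _ (splice F')); last exact/rst_sym/rst_step.
exact/yoneda_splice/E0.
Qed.

End Yoneda.

(** * Reversal of extensions *)

Section At.
Variable C : preadditive.

(** In a reversed sequence the indices [n.+1 - j.+1] and [n.+1 - j] are consecutive only
    propositionally, and only in range; hence the cast and the default 0. *)
Definition diff_at (S : sequence C) (a b : nat) : hom (S a) (S b) :=
  if @eqP _ a.+1 b is ReflectT e then
    eq_rect _ (fun k => hom (S a) (S k)) (diff S a) _ e else 0%R.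

Lemma diff_atE (S : sequence C) a : diff_at S a a.+1 = diff S a.
Proof. by rewrite /diff_at; case: eqP => // e; rewrite eq_axiomK. Qed.

Definition id_at (S : sequence C) (a b : nat) : hom (S a) (S b) :=
  if @eqP _ a b is ReflectT e then
    eq_rect _ (fun k => hom (S a) (S k)) (idm (S a)) _ e else 0%R.

Lemma id_atE (S : sequence C) a : id_at S a a = idm (S a).
Proof. by rewrite /id_at; case: eqP => // e; rewrite eq_axiomK. Qed.

Definition in_at n (X Y : C) (E : extension n X Y) (k : nat) : hom Y (E k) :=
  if k is 0 return hom Y (E k) then ext_in E else 0%R.

End At.

(* The two categories have opposite compositions but unrelated proofs of the
   axioms: op (op C) has the data of C but is not convertible to C. *)
Section Reversal.
Variables (T : Type) (h : T -> T -> zmodType) (i : forall X, h X X).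
Variable c : forall X Y Z, h Y Z -> h X Y -> h X Z.
Variables (p1 : forall W X Y Z (f : h Y Z) (g : h X Y) (k : h W X),
             c f (c g k) = c (c f g) k)
  (p2 : forall X Y (f : h X Y), c (i Y) f = f)
  (p3 : forall X Y (f : h X Y), c f (i X) = f)
  (p4 : forall X Y Z (g g' : h Y Z) (f : h X Y),
    c (g + g')%R f = (c g f + c g' f)%R)
  (p5 : forall X Y Z (g : h Y Z) (f f' : h X Y),
    c g (f + f')%R = (c g f + c g f')%R).
Variables (q1 : forall W X Y Z (f : h Z Y) (g : h Y X) (k : h X W),
             c (c k g) f = c k (c g f))
  (q2 : forall X Y (f : h Y X), c f (i Y) = f)
  (q3 : forall X Y (f : h Y X), c (i X) f = f)
  (q4 : forall X Y Z (g g' : h Z Y) (f : h Y X),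
    c f (g + g')%R = (c f g + c f g')%R)
  (q5 : forall X Y Z (g : h Z Y) (f f' : h Y X),
    c (f + f')%R g = (c f g + c f' g)%R).

Let C := @Preadditive T h i c p1 p2 p3 p4 p5.
Let D := @Preadditive T (fun X Y => h Y X) i (fun X Y Z g f => c f g) q1 q2 q3 q4 q5.

Section Rev.
Variables (n : nat) (X Y : C) (E : extension n X Y).

Definition rev_seq : sequence D :=
  @Sequence D (fun j => E (n.+1 - j)) (fun j => diff_at E (n.+1 - j.+1) (n.+1 - j)).

Lemma exact_rev (A B K : C) (f : hom A B) (g : hom B K) :
  exact f g -> @exact D K B A g f.
Proof.
move=> [J [m [[Q [d [fd dm]]] gm]]]; exists Q, d; split; last exact: fd.
exists J, m; split; first exact: gm.
have [e fe] := kernel_lift dm (proj1 fd).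
apply: (@cokernelP C); first exact: cokernel_epi fd.
  exact: proj1 dm.
move=> W k km; apply: (cokernel_desc fd).
by rewrite fe compA km comp0m.
Qed.

Lemma rev_mono : @mono D _ _ (diff rev_seq 0).
Proof.
(* The subtractions become free indices with equations, and substitution removes the cast; the same
   device recurs below. *)
suff hE a b : b = a.+1 -> a = n -> @epi C _ _ (diff_at E a b).
  by apply: hE; rewrite ?subn0 ?subn1.
by move=> -> ->; rewrite diff_atE; apply: ext_epi.
Qed.

Lemma rev_epi : @epi D _ _ (diff rev_seq n).
Proof.
suff hE a b : b = 1 -> a = 0 -> @mono C _ _ (diff_at E a b).
  by apply: hE; rewrite ?subnn ?subSnn.
by move=> -> ->; rewrite diff_atE; apply: ext_mono.
Qed.

Lemma rev_exact j : (j < n)%N -> @exact D _ _ _ (diff rev_seq j) (diff rev_seq j.+1).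
Proof.
move=> lt_jn; apply: exact_rev.
suff hE a b d : b = a.+1 -> d = b.+1 -> (a < n)%N ->
    @exact C _ _ _ (diff_at E a b) (diff_at E b d).
  by apply: hE; rewrite !subSS; lia.
by move=> -> -> lt_an; rewrite !diff_atE; apply: ext_exact.
Qed.

Lemma rev_in_iso : @is_iso D X (rev_seq 0) (ext_out E).
Proof. by have [g [e1 e2]] := ext_out_iso E; exists g. Qed.

Lemma rev_out_iso : @is_iso D (rev_seq n.+1) Y (in_at E (n.+1 - n.+1)).
Proof.
suff hE k : k = 0 -> @is_iso C Y (E k) (in_at E k).
  by have [g [e1 e2]] := hE _ (subnn n.+1); exists g.
by move=> ->; apply: ext_in_iso.
Qed.

Definition rev_ext : @extension D n Y X :=
  @Extension D n Y X rev_seq (ext_out E) (in_at E (n.+1 - n.+1))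
    rev_in_iso rev_out_iso rev_mono rev_exact rev_epi.

End Rev.

Lemma rev_morphism n (X Y : C) (E E' : extension n X Y) :
  ext_morphism E E' -> ext_morphism (rev_ext E') (rev_ext E).
Proof.
move=> [phi [e1 e2 e3]]; exists (fun j => phi (n.+1 - j)); split.
- move=> j le_jn.
  suff hE a b : b = a.+1 -> (a <= n)%N ->
      phi b ∘ diff_at E a b = diff_at E' a b ∘ phi a.
    by apply/esym/hE; lia.
  by move=> -> le_an; rewrite !diff_atE e1.
- exact: e3.
- suff hE k : k = 0 -> phi k ∘ in_at E k = in_at E' k by apply: hE; apply: subnn.
  by move=> ->.
Qed.

End Reversal.

Section RevRev.
Variables (T : Type) (h : T -> T -> zmodType) (i : forall X, h X X).
Variable c : forall X Y Z, h Y Z -> h X Y -> h X Z.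
Variables (p1 : forall W X Y Z (f : h Y Z) (g : h X Y) (k : h W X),
             c f (c g k) = c (c f g) k)
  (p2 : forall X Y (f : h X Y), c (i Y) f = f)
  (p3 : forall X Y (f : h X Y), c f (i X) = f)
  (p4 : forall X Y Z (g g' : h Y Z) (f : h X Y),
    c (g + g')%R f = (c g f + c g' f)%R)
  (p5 : forall X Y Z (g : h Y Z) (f f' : h X Y),
    c g (f + f')%R = (c g f + c g f')%R).
Variables (q1 : forall W X Y Z (f : h Z Y) (g : h Y X) (k : h X W),
             c (c k g) f = c k (c g f))
  (q2 : forall X Y (f : h Y X), c f (i Y) = f)
  (q3 : forall X Y (f : h Y X), c (i X) f = f)
  (q4 : forall X Y Z (g g' : h Z Y) (f : h Y X),
    c f (g + g')%R = (c f g + c f g')%R)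
  (q5 : forall X Y Z (g : h Z Y) (f f' : h Y X),
    c (f + f')%R g = (c f g + c f' g)%R).

Let C := @Preadditive T h i c p1 p2 p3 p4 p5.
Let D := @Preadditive T (fun X Y => h Y X) i (fun X Y Z g f => c f g) q1 q2 q3 q4 q5.

Let revC n (X Y : C) : extension n X Y -> @extension D n Y X :=
  @rev_ext T h i c p1 p2 p3 p4 p5 q1 q2 q3 q4 q5 n X Y.
Let revD n (X Y : D) : extension n X Y -> @extension C n Y X :=
  @rev_ext T (fun X Y => h Y X) i (fun X Y Z g f => c f g)
    q1 q2 q3 q4 q5 p1 p2 p3 p4 p5 n X Y.

(** Reversing twice returns E only up to the index [n.+1 - (n.+1 - j)]; cast identities give a
    morphism, which suffices for Yoneda equivalence. *)
Lemma rev_rev n (X Y : C) (E : extension n X Y) : ext_morphism E (revD (revC E)).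
Proof.
exists (fun j => id_at E j (n.+1 - (n.+1 - j))); split.
- move=> j le_jn /=.
  suff hE a b : b = a.+1 -> n.+1 - b = j -> n.+1 - a = j.+1 ->
      id_at E j.+1 (n.+1 - a) ∘ diff E j =
      (diff_at (revC E) a b : @hom C (E (n.+1 - b)) (E (n.+1 - a)))
        ∘ id_at E j (n.+1 - b) by apply: hE; lia.
  move=> -> + e2; rewrite diff_atE /= e2.
  move: (n.+1 - a.+1) => k ->.
  rewrite diff_atE !id_atE; exact: etrans (p2 _) (esym (p3 _)).
- suff hE k : k = 0 -> id_at E 0 k ∘ ext_in E = in_at E k.
    by apply: hE; apply: subnn.
  by move=> ->; rewrite id_atE comp1m.
- suff hE k : k = 0 ->
      (in_at (revC E) k : @hom C (E (n.+1 - k)) X) ∘ id_at E n.+1 (n.+1 - k)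
      = ext_out E by apply: hE; apply: subnn.
  move=> ->; have := @compm1 C _ _ (ext_out E).
  by rewrite -[X in _ ∘ X = _ -> _](id_atE E n.+1).
Qed.

Lemma rev_yoneda n (X Y : C) (E E' : extension n X Y) :
  yoneda_eq E E' -> yoneda_eq (revC E) (revC E').
Proof.
elim=> {E E'} [E E' EE'|E|E E' _|E E' E'' _ + _].
- exact/rst_sym/rst_step/rev_morphism.
- exact: rst_refl.
- exact: rst_sym.
- exact: rst_trans.
Qed.

End RevRev.

Lemma Ext_zero_dual (T : Type) (h : T -> T -> zmodType) i c
    p1 p2 p3 p4 p5 q1 q2 q3 q4 q5 n (X Y : T) :
  @Ext_zero (@Preadditive T h i c p1 p2 p3 p4 p5) n X Y ->
  @Ext_zero (@Preadditive T (fun X Y => h Y X) i (fun X Y Z g f => c _ _ _ f g)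
    q1 q2 q3 q4 q5) n Y X.
Proof.
case: n => [//|n] C0 E E'.
have EE' := C0 (rev_ext p1 p2 p3 p4 p5 E) (rev_ext p1 p2 p3 p4 p5 E').
apply: rst_trans (rst_step _ _ _ _ (rev_rev p1 p2 p3 p4 p5 E)) _.
apply: rst_trans _ (rst_sym _ _ _ _ (rst_step _ _ _ _ (rev_rev p1 p2 p3 p4 p5 E'))).
exact: (rev_yoneda q1 q2 q3 q4 q5 EE').
Qed.

Lemma Ext_zero_op (C : preadditive) n (X Y : C) :
  Ext_zero n X Y <-> @Ext_zero (op C) n Y X.
Proof.
case: C X Y => T h i c p1 p2 p3 p4 p5 X Y; split; first exact: Ext_zero_dual.
exact: (@Ext_zero_dual T (fun X Y => h Y X) i (fun X Y Z g f => c _ _ _ f g)).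
Qed.

(** * Torsion pairs in length categories *)

Section Torsion.
Local Open Scope ring_scope.
Import GRing.Theory.
Variable C : preadditive.
Hypothesis Cab : abelian C.
Implicit Types A B E I K N P Q R S W X Y Z : C.

Lemma isomorphic_zero X Y : isomorphic X Y -> is_zero X -> is_zero Y.
Proof.
move=> [f [g [_ fg]]] [X0 X0']; split=> Z h.
  by rewrite -(comp1m h) -fg -compA (X0 _ (g ∘ h)) compm0.
by rewrite -(compm1 h) -fg compA (X0' _ (h ∘ f)) comp0m.
Qed.

Lemma idm0_zero X : idm X = 0 -> is_zero X.
Proof.
move=> id0; split=> Z h; first by rewrite -(comp1m h) id0 comp0m.
by rewrite -(compm1 h) id0 compm0.
Qed.

Lemma zero_mono Z Y (f : hom Z Y) : is_zero Z -> mono f.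
Proof. by move=> [Z0 _] W g h _; rewrite (Z0 _ g) (Z0 _ h). Qed.

Lemma zero_cokernel_iso A B K (a : hom A B) (c : hom B K) :
  short_exact a c -> is_zero K -> is_iso a.
Proof.
move=> ac [K0 _]; have [|g ag] := kernel_lift (h := idm B) (proj1 ac).
  by rewrite compm1.
exists g; split=> //; apply: (ses_mono ac).
by rewrite compA -ag comp1m compm1.
Qed.

Lemma zero_kernel_iso A B K (a : hom A B) (c : hom B K) :
  short_exact a c -> is_zero A -> is_iso c.
Proof.
move=> ac [_ A0]; have [|g cg] := cokernel_desc (h := idm B) (proj2 ac).
  by rewrite comp1m.
exists g; split=> //; apply: (ses_epi ac).
by rewrite -compA -cg comp1m compm1.
Qed.

Lemma simple_iso S R (s : hom S R) : is_iso s -> simple S -> simple R.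
Proof.
move=> siso [S0 Ssimple]; split.
  by move=> R0; apply: S0; apply: isomorphic_zero R0; apply/isomorphic_sym; exists s.
move=> X f mf; have [t [ts st]] := siso.
have tiso : is_iso t by exists s.
have mtf : mono (t ∘ f) by apply: mono_comp => //; apply: iso_mono.
have [X0|tf] := Ssimple _ _ mtf; [by left|right].
by rewrite -(comp1m f) -st -compA; apply: iso_comp.
Qed.

Lemma simple_quotient S R (s : hom S R) : epi s -> simple S -> is_zero R \/ is_iso s.
Proof.
move=> es [S0 Ssimple]; have [K [k ks]] := epi_ses Cab es.
have [K0|kiso] := Ssimple _ _ (ses_mono ks); first by right; apply: zero_kernel_iso ks K0.
left; apply/idm0_zero/(epi_eq0 es); rewrite comp1m.
by apply: (epi_eq0 (iso_epi kiso)); apply: ses_comp0 ks.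
Qed.

(** Zero factors are allowed so that the bound passes to quotients, where a simple factor may
    vanish. *)
Fixpoint length_le (k : nat) (X : C) : Prop :=
  if k is j.+1 then
    exists (X' S : C) (i : hom X' X) (p : hom X S),
      [/\ length_le j X', short_exact i p & is_zero S \/ simple S]
  else is_zero X.

Lemma composition_length X : has_composition_series X -> exists k, length_le k X.
Proof.
elim=> {X} [X X0|X' X S i p _ [k kX'] ip S1]; first by exists 0%N.
by exists k.+1, X', S, i, p; split=> //; right.
Qed.

(** The last filtration step descends to a quotient N: I is the image of X' and R = N / I is a
    quotient of S. *)
Lemma quotient_step X' X S N (i : hom X' X) (p : hom X S) (q : hom X N) :
  short_exact i p -> epi q -> exists (I R : C) (e : hom X' I) (m : hom I N)
    (r : hom N R) (s : hom S R),
    [/\ epi e, short_exact m r, m ∘ e = q ∘ i, s ∘ p = r ∘ q & epi s].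
Proof.
move=> ip eq; have [I [e [m [ee mm qi]]]] := image_factor Cab (q ∘ i).
have [R [r mr]] := mono_ses Cab mm.
have [|s sp] := cokernel_desc (h := r ∘ q) (proj2 ip).
  by rewrite -compA qi compA (ses_comp0 mr) comp0m.
exists I, R, e, m, r, s; split=> //.
apply: (@epi_compl _ _ _ _ _ p); rewrite -sp.
by apply: epi_comp => //; apply: ses_epi mr.
Qed.

Lemma quotient_zero_or_simple S R (s : hom S R) :
  epi s -> is_zero S \/ simple S -> is_zero R \/ is_iso s /\ simple R.
Proof.
move=> es [[S0 S0']|S1]; last first.
  have [R0|siso] := simple_quotient es S1; first by left.
  by right; split=> //; apply: simple_iso siso S1.
by left; apply/idm0_zero/(epi_eq0 es); rewrite comp1m.
Qed.

Lemma length_le_quotient k X N (q : hom X N) : epi q -> length_le k X -> length_le k N.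
Proof.
elim: k X N q => [|k IH] X N q eq /=.
  by move=> [X0 X0']; apply/idm0_zero/(epi_eq0 eq); rewrite comp1m.
move=> [X' [S [i [p [kX' ip S1]]]]].
have [I [R [e [m [r [s [ee mr _ _ es]]]]]]] := quotient_step ip eq.
exists I, R, m, r; split=> //; first exact: IH ee kX'.
by have [|[]] := quotient_zero_or_simple es S1; [left|right].
Qed.

(** Either the top factor dies and N is a quotient of X', or it survives, and then X' -> I is again
    a proper quotient and induction applies. *)
Lemma length_le_proper k X N (q : hom X N) :
  epi q -> ~ mono q -> length_le k.+1 X -> length_le k N.
Proof.
elim: k X N q => [|k IH] X N q eq nq [X' [S [i [p [kX' ip S1]]]]];
  have [I [R [e [m [r [s [ee mr meq spr es]]]]]]] := quotient_step ip eq;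
  have [R0|[siso R1]] := quotient_zero_or_simple es S1.
- apply: (@length_le_quotient 0 X' N (m ∘ e) _ kX'); apply: epi_comp => //.
  exact/iso_epi/(zero_cokernel_iso mr).
- case: nq; apply: mono0 => W x qx.
  have px : p ∘ x = 0.
    by apply: (mono_eq0 (iso_mono siso)); rewrite compA spr -compA qx compm0.
  have [y ->] := kernel_lift (proj1 ip) px.
  by rewrite (proj1 kX' _ y) compm0.
- apply: (@length_le_quotient k.+1 X' N (m ∘ e) _ kX'); apply: epi_comp => //.
  exact/iso_epi/(zero_cokernel_iso mr).
exists I, R, m, r; split=> //; last by right.
apply: IH ee _ kX' => me; case: nq; apply: mono0 => W x qx.
have px : p ∘ x = 0.
  by apply: (mono_eq0 (iso_mono siso)); rewrite compA spr -compA qx compm0.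
have [y xy] := kernel_lift (proj1 ip) px.
rewrite xy; suff -> : y = 0 by rewrite compm0.
apply: (mono_eq0 me); apply: (mono_eq0 (ses_mono mr)).
by rewrite compA meq -compA -xy qx.
Qed.

(** * The torsion pair generated by a class *)

Definition rperp (U : subcat C) : subcat C :=
  fun Y => forall X (f : hom X Y), U X -> f = 0.

Definition lperp (F : subcat C) : subcat C :=
  fun X => forall Y (f : hom X Y), F Y -> f = 0.

Lemma rperp_iso (U : subcat C) : iso_closed (rperp U).
Proof.
move=> Y Y' [f [g [_ fg]]] UY X h UX.
by rewrite -(comp1m h) -fg -compA (UY _ (g ∘ h)) // compm0.
Qed.

Lemma lperp_iso (F : subcat C) : iso_closed (lperp F).
Proof.
move=> Y Y' [f [g [_ fg]]] FY X h FX.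
by rewrite -(compm1 h) -fg compA (FY _ (h ∘ f)) // comp0m.
Qed.

Hypothesis Clen : length_category C.

(** While some nonzero V -> M with V in U exists, divide M by its image I; the length drops, so this
    stops. The torsion part of M is the preimage of that of M / I. *)
Lemma generated_torsion_pair (U : subcat C) :
  torsion_pair (lperp (rperp U)) (rperp U).
Proof.
split; [exact: lperp_iso|exact: rperp_iso|by move=> X Y f TX; apply: TX|].
move=> M; have [k kM] := composition_length (Clen M).
have [Z Z0] := has_zero Cab.
have trivial N : rperp U N -> exists X Y (i : hom X N) (p : hom N Y),
    torsion_sequence (lperp (rperp U)) (rperp U) i p.
  move=> UN; exists Z, N, 0, (idm N); split=> //.
    apply: (epi_kernel_ses Cab); first exact/iso_epi/iso_id.
    apply: kernelP; [exact: zero_mono|by rewrite compm0|].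
    by move=> W h; rewrite comp1m => ->; exists 0; rewrite comp0m.
  by move=> Y f _; apply: (proj2 Z0).
elim: k M kM => [|k IH] M kM.
  by apply: trivial => X f _; apply: (proj1 kM).
case: (classic (rperp U M)) => [/trivial //|nUM].
have [V [f [UV f0]]] : exists V (f : hom V M), U V /\ f <> 0.
  apply: NNPP => nV; apply: nUM => V f UV; apply: NNPP => f0; apply: nV.
  by exists V, f.
have [I [e [m [ee mm fme]]]] := image_factor Cab f.
have TI : lperp (rperp U) I.
  by move=> Y g UY; apply: (epi_eq0 ee); apply: UY UV.
have [N [q mq]] := mono_ses Cab mm.
have nq : ~ mono q.
  move=> mono_q; apply: f0; rewrite fme.
  by rewrite (mono_eq0 mono_q (ses_comp0 mq)) comp0m.
have [X' [Y [i' [p' [ip' TX' FY]]]]] := IH N (length_le_proper (ses_epi mq) nq kM).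
have epq : epi (p' ∘ q) by apply: epi_comp; [apply: ses_epi ip'|apply: ses_epi mq].
have [X [x xpq]] := epi_ses Cab epq.
have op_ses A B K (a : hom A B) (c : hom B K) :
    short_exact a c -> @short_exact (op C) _ _ _ c a by case.
(* The third isomorphism theorem in the opposite category yields the short exact sequence I -> X ->
   X'. *)
have [y [j [jy _ _]]] := ses_third (abelian_op Cab) (op_ses _ _ _ _ _ ip')
  (op_ses _ _ _ _ _ mq) (op_ses _ _ _ _ _ xpq).
have {}jy : @short_exact C _ _ _ j y by case: jy.
exists X, Y, x, (p' ∘ q); split=> // W g UW.
have [g' ->] := cokernel_desc (proj2 jy) (TI _ (g ∘ j) UW).
by rewrite (TX' _ g' UW) comp0m.
Qed.

(** If T contains U, its torsion-free objects lie in [rperp U], so the torsion-free quotient of an X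
    in [lperp (rperp U)] is zero. *)
Lemma torsion_closureP (U : subcat C) : torsion_closure U ≡ lperp (rperp U).
Proof.
move=> X; split=> [UX|UX T [F [Tiso Fiso TF seqs]] UT].
  apply: UX; first by exists (rperp U); apply: generated_torsion_pair.
  by move=> Y UY Z f UZ; apply: UZ UY.
have [A [B [i [p [ip TA FB]]]]] := seqs X.
have p0 : p = 0 by apply: UX => Z f UZ; apply: TF (UT _ UZ) FB.
apply: Tiso TA; exists i; apply: (zero_cokernel_iso ip).
by apply/idm0_zero/(epi_eq0 (ses_epi ip)); rewrite comp1m.
Qed.

Lemma torsion_pair_eq (T T' F : subcat C) :
  T ≡ T' -> torsion_pair T F -> torsion_pair T' F.
Proof.
move=> TT' [Tiso Fiso TF seqs]; split=> //.
- by move=> X Y XY /TT' TX; apply/TT'; apply: Tiso XY TX.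
- by move=> X Y f /TT'; apply: TF.
move=> M; have [X [Y [i [p [ip /TT' TX FY]]]]] := seqs M.
by exists X, Y, i, p.
Qed.

Lemma closure_torsion_pair (U : subcat C) :
  torsion_pair (torsion_closure U) (rperp U).
Proof.
apply: (torsion_pair_eq _ (generated_torsion_pair U)) => X.
by split=> /torsion_closureP.
Qed.

Lemma closure_least (U : subcat C) : least_torsion_class U (torsion_closure U).
Proof.
split; first by exists (rperp U); apply: closure_torsion_pair.
  by move=> X UX T _; apply.
by move=> T tT UT X; apply.
Qed.

Lemma torsion_free_rperp (U T F : subcat C) : torsion_pair T F ->
  T ≡ torsion_closure U -> F ≡ rperp U.
Proof.
move=> [Tiso Fiso TF seqs] TU Y; split=> [FY X f UX|UY].
  by apply: TF FY; apply/TU; case: (closure_least U) => _ h _; apply: h.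
have [A [B [i [p [ip /TU /torsion_closureP TA FB]]]]] := seqs Y.
apply: Fiso FB; apply: isomorphic_sym; exists p; apply: (zero_kernel_iso ip).
have i0 : i = 0 by apply: TA.
by apply/idm0_zero/(mono_eq0 (ses_mono ip)); rewrite compm1.
Qed.

Lemma torsion_sequence_hom (T F : subcat C) X M Y X' M' Y' (i : hom X M)
    (p : hom M Y) (i' : hom X' M') (p' : hom M' Y') (f : hom M M') :
  torsion_pair T F -> torsion_sequence T F i p -> torsion_sequence T F i' p' ->
  exists g h, f ∘ i = i' ∘ g /\ p' ∘ f = h ∘ p.
Proof.
move=> [_ _ TF _] [ip TX FY] [ip' TX' FY'].
have pfi : p' ∘ f ∘ i = 0 by apply: TF.
have [h hP] := cokernel_desc (proj2 ip) pfi.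
rewrite -compA in pfi; have [g gP] := kernel_lift (proj1 ip') pfi.
by exists g, h.
Qed.

Lemma torsion_sequence_unique (T F : subcat C) X M Y X' M' Y' (i : hom X M)
    (p : hom M Y) (i' : hom X' M') (p' : hom M' Y') :
  torsion_pair T F -> isomorphic M M' ->
  torsion_sequence T F i p -> torsion_sequence T F i' p' ->
  isomorphic X X' /\ isomorphic Y Y'.
Proof.
move=> TF [f [f' [f'f ff']]] ip ip'.
have [g [h [gP hP]]] := torsion_sequence_hom f TF ip ip'.
have [g' [h' [gP' hP']]] := torsion_sequence_hom f' TF ip' ip.
case: ip ip' => [ip _ _] [ip' _ _].
split; [exists g, g'|exists h, h']; split.
- by apply: (ses_mono ip); rewrite compA -gP' -compA -gP compA f'f comp1m compm1.
- by apply: (ses_mono ip'); rewrite compA -gP -compA -gP' compA ff' comp1m compm1.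
- by apply: (ses_epi ip); rewrite -compA -hP compA -hP' -compA f'f comp1m compm1.
- by apply: (ses_epi ip'); rewrite -compA -hP' compA -hP -compA ff' comp1m compm1.
Qed.

End Torsion.

(** * Resolutions *)

(** Induction on the degree: for Y embedded in an object of M, the cokernel has vanishing Ext one
    degree lower, as [Ext_zero_shift] asks. *)
Lemma Ext_null_zero (C : preadditive) (M : subcat C) n (X : C) :
  abelian C -> cogenerating M ->
  (forall M' i, M M' -> (0 < i < n)%N -> Ext_zero i X M') ->
  forall i Y, (0 < i < n)%N -> Ext_null X i Y -> Ext_zero i X Y.
Proof.
move=> Cab cog XM; elim=> [//|[|i] IH] Y lt_in nY; first exact: Ext1_null_zero.
apply: (Ext_zero_shift Cab) => D a ma; have [M0 [b [MM0 mb]]] := cog D.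
have mba : mono (b ∘ a) by apply: mono_comp.
have [K [c bac]] := mono_ses Cab mba.
exists (Ses bac), b; split=> //; apply: IH; first by lia.
apply: (Ext_null_cokernel Cab bac) => //; apply: (Ext_zero_null Cab).
by apply: XM => //; lia.
Qed.

Section Resolution.
Local Open Scope ring_scope.
Import GRing.Theory.
Variable C : preadditive.
Hypothesis Cab : abelian C.
Implicit Types A B E I K N P Q R W X Y Z : C.

(* The exact sequence 0 -> S 0 -> ... -> S n.+1 -> 0 is cut into the short exact
   sequences 0 -> L i -> S i.+1 -> L i.+1 -> 0, L i being the image of diff S i. *)
Record resolved (n : nat) (S : sequence C) := Resolved {
  rL : nat -> C;
  rq : forall i, hom (S i) (rL i);
  ra : forall i, hom (rL i) (S i.+1);
  r_diff : forall i, diff S i = ra i ∘ rq i;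
  r_fst : is_iso (rq 0%N);
  r_last : is_iso (ra n);
  r_ses : forall i, (i < n)%N -> short_exact (ra i) (rq i.+1) }.

Definition onto (n : nat) (S : sequence C) (r : resolved n S) X i : Prop :=
  forall f : hom X (rL r i), exists h, f = rq r i ∘ h.

Section Resolved.
Variables (n : nat) (S : sequence C) (r : resolved n S).

Lemma ra_mono i : (i <= n)%N -> mono (ra r i).
Proof.
rewrite leq_eqVlt => /orP[/eqP ->|lt_in]; first exact: iso_mono (r_last r).
exact: ses_mono (r_ses r lt_in).
Qed.

Lemma ra_iso i : i = n -> is_iso (ra r i).
Proof. by move=> ->; apply: r_last. Qed.

Lemma rq_epi i : (i <= n)%N -> epi (rq r i).
Proof.
case: i => [|i] le_in; first exact: iso_epi (r_fst r).
exact: ses_epi (r_ses r le_in).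
Qed.

Lemma resolved_kernel i X (x : hom X (S i.+1)) : (i < n)%N ->
  diff S i.+1 ∘ x = 0 <-> exists y, x = ra r i ∘ y.
Proof.
move=> lt_in; rewrite (r_diff r) -compA; split=> [|[y ->]].
  move=> /(mono_eq0 (@ra_mono i.+1 lt_in)); apply: kernel_lift.
  exact: (proj1 (r_ses r lt_in)).
by rewrite (compA _ (ra r i)) (ses_comp0 (r_ses r lt_in)) comp0m compm0.
Qed.

Lemma resolved_cokernel i X (x : hom (S i.+1) X) : (i < n)%N ->
  x ∘ diff S i = 0 <-> exists y, x = y ∘ rq r i.+1.
Proof.
move=> lt_in; rewrite (r_diff r) compA; split=> [|[y ->]].
  move=> /(epi_eq0 (rq_epi (ltnW lt_in))); apply: cokernel_desc.
  exact: (proj2 (r_ses r lt_in)).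
by rewrite -(compA y) (ses_comp0 (r_ses r lt_in)) compm0 comp0m.
Qed.

(** L 1 is the kernel of S 2 -> S 3, so injectivity on Hom(X, S 2) means Hom(X, L 1) = 0; exactness
    further on says that maps to L i lift to S i. *)
Lemma hom_exactP X : (0 < n)%N -> hom_exact X S 2 n.+1 <->
  (forall f : hom X (rL r 1%N), f = 0) /\ forall i, (1 < i <= n)%N -> onto r X i.
Proof.
move=> n_gt0; split=> [[inj ex]|[L0 surj]]; split.
- move=> f; apply: (mono_eq0 (ra_mono n_gt0)); apply: inj => lt_2n.
  by apply/(@resolved_kernel 1%N X _ lt_2n); exists f.
- move=> i lt_in f; have lt_i : (1 < i < n.+1)%N by lia.
  have [|h hP] := proj1 (ex i lt_i (ra r i ∘ f)).
    by move=> lt_i1; apply/(resolved_kernel _ lt_i1); exists f.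
  exists h; apply: (@ra_mono i); first by lia.
  by rewrite hP (r_diff r) compA.
- move=> h ker_h.
  (* For n = 1 the kernel condition is void, but then [ra r 1] is the isomorphism onto the last
     term. *)
  have [y ->] : exists y, h = ra r 1%N ∘ y.
    have [lt_1n|le_n1] := ltnP 1 n; first by apply/(resolved_kernel _ lt_1n)/ker_h.
    have [|t [_ ta]] := @ra_iso 1%N; first by lia.
    exists (t ∘ h).
    by rewrite compA ta comp1m.
  by rewrite (L0 y) compm0.
move=> i lt_in h; split=> [ker_h|[h' ->] lt_i1]; last first.
  by apply/(resolved_kernel _ lt_i1); exists (rq r i ∘ h'); rewrite (r_diff r) compA.
have [y ->] : exists y, h = ra r i ∘ y.
  have [lt_i|le_n] := ltnP i n; first by apply/(resolved_kernel _ lt_i)/ker_h.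
  have [|t [_ ta]] := @ra_iso i; first by lia.
  exists (t ∘ h).
  by rewrite compA ta comp1m.
have [|h' ->] := surj i _ y; first by lia.
by exists h'; rewrite (r_diff r) compA.
Qed.

End Resolved.

Variables (n : nat) (M : subcat C).

(** Monomorphisms and kernels may be tested on covers by objects of M, epimorphisms on embeddings
    into them. *)
Lemma n_exact_resolved S : generating M -> cogenerating M -> (0 < n)%N ->
  n_exact n M S -> exists _ : resolved n S, True.
Proof.
move=> gen cog n_gt0 [MS cokS kerS].
have fac i : exists t : {I : C & (hom (S i) I * hom I (S i.+1))%type},
    [/\ epi (projT2 t).1, mono (projT2 t).2
      & diff S i = (projT2 t).2 ∘ (projT2 t).1].
  have [J [e [m [ee mm d]]]] := image_factor Cab (diff S i).
  by exists (existT _ J (e, m)).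
pose g i := constructive_indefinite_description _ (fac i).
pose L i := projT1 (proj1_sig (g i)).
pose q i : hom (S i) (L i) := (projT2 (proj1_sig (g i))).1.
pose a i : hom (L i) (S i.+1) := (projT2 (proj1_sig (g i))).2.
have eq i : epi (q i) by have [] := proj2_sig (g i).
have ma i : mono (a i) by have [] := proj2_sig (g i).
have dE i : diff S i = a i ∘ q i by have [] := proj2_sig (g i).
have d_mono : mono (diff S 0).
  apply: mono0 => W x dx; have [M0 [e [MM0 ee]]] := gen W.
  apply: (epi_eq0 ee); apply: (proj1 (kerS _ MM0)).
  by rewrite compA dx comp0m.
have d_epi : epi (diff S n).
  apply: epi0 => W x dx; have [M0 [e [MM0 ee]]] := cog W.
  apply: (mono_eq0 ee); apply: (proj1 (cokS _ MM0)).
  by rewrite -compA dx compm0.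
have q0 : is_iso (q 0%N).
  apply: (mono_epi_iso Cab) => //.
  by apply: (@mono_compr _ _ _ _ (a 0%N)); rewrite -dE.
have an : is_iso (a n).
  apply: (mono_epi_iso Cab) => //.
  by apply: (@epi_compl _ _ _ _ _ (q n)); rewrite -dE.
suff s i : (i < n)%N -> short_exact (a i) (q i.+1) by exists (Resolved dE q0 an s).
move=> lt_in; apply: (epi_kernel_ses Cab) => //; apply: kernelP => // [|W x qx].
  apply: (epi_eq0 (eq i)); apply: (mono_eq0 (ma i.+1)).
  rewrite -compA -dE compA -dE.
  apply/(proj2 (kerS (S i) (MS i _)) i lt_in); first by lia.
  by exists (idm _); rewrite compm1.
have [M0 [e [MM0 ee]]] := gen W.
have [|h' hP] := proj1 (proj2 (kerS _ MM0) i lt_in (x ∘ e)).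
  by rewrite compA dE -(compA (a i.+1)) qx compm0 comp0m.
have [Q [c ac]] := mono_ses Cab (ma i).
apply: (kernel_lift (proj1 ac)); apply: (epi_eq0 ee).
by rewrite -compA hP dE !compA (ses_comp0 ac) !comp0m.
Qed.

End Resolution.

(** * n-torsion classes *)

Section Resolutions.
Variable C : preadditive.
Hypothesis Cab : abelian C.
Variables (n : nat) (M : subcat C).
Hypothesis n_gt0 : (0 < n)%N.
Hypothesis Mct : cluster_tilting n M.
Implicit Types A B E I K N P Q R W X Y Z : C.

Let gen : generating M. Proof. by case: Mct => _ _ []. Qed.
Let cog : cogenerating M. Proof. by case: Mct => _ _ []. Qed.

Lemma ct_zero X Y i : M X -> M Y -> (0 < i < n)%N -> Ext_zero i X Y.
Proof. by case: Mct => _ _ _ + _ => h /h; apply. Qed.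

Lemma ct_null X Y i : M X -> M Y -> (0 < i < n)%N -> Ext_null X i Y.
Proof. by move=> MX MY lt_in; apply: (Ext_zero_null Cab); apply: ct_zero. Qed.

Lemma ct_null_zero X Y i : M X -> (0 < i < n)%N -> Ext_null X i Y -> Ext_zero i X Y.
Proof.
move=> MX; apply: (Ext_null_zero Cab cog) => M' j MM' lt_jn; exact: ct_zero.
Qed.

Definition approximating K (s : ses K) : Prop :=
  M (sB s) /\ forall M' (g : hom K M'), M M' -> exists h, g = h ∘ sa s.

(** A left approximation is mono because an embedding of K into an object of M factors through it.
    For K in M the identity is chosen, so that the resolution can end there. *)
Lemma approximating_ex K :
  exists s : ses K, approximating s /\ (M K -> is_iso (sa s)).
Proof.
case: (classic (M K)) => [MK|nMK].
  have [Z Z0] := has_zero Cab.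
  exists (Ses (ses_to_zero Cab K Z0)); split=> /=; last by move=> _; apply: iso_id.
  by split=> //= M' g _; exists g; rewrite compm1.
have [_ [_ lapp] _ _ _] := Mct.
have [V [f [MV fV]]] := lapp K; have [M0 [b [MM0 mb]]] := cog K.
have [b' bP] := fV _ b MM0.
have mf : mono f by apply: (@mono_compr _ _ _ _ b'); rewrite -bP.
have [Q [c fc]] := mono_ses Cab mf.
by exists (Ses fc).
Qed.

Definition approx K : ses K :=
  proj1_sig (constructive_indefinite_description _ (approximating_ex K)).

Let approx_spec K : approximating (approx K) /\ (M K -> is_iso (sa (approx K))).
Proof.
exact: (proj2_sig (constructive_indefinite_description _ (approximating_ex K))).
Qed.

Lemma approxP K : approximating (approx K).
Proof. exact: (proj1 (approx_spec K)). Qed.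

Lemma approx_iso K : M K -> is_iso (sa (approx K)).
Proof. exact: (proj2 (approx_spec K)). Qed.

(* Contravariant dimension shifting, carried out in the opposite category. *)
Lemma cosyzygy_in_ct (L : nat -> C) (s : forall i, ses (L i)) :
  (forall i, approximating (s i)) -> (forall i, L i.+1 = sK (s i)) -> M (L n.-1).
Proof.
move=> sM Ls.
(* That is, Ext^k(L j, M') = 0 for 0 < k <= j and k < n. Degree 1 uses the approximation property,
   higher degrees shift to j - 1; at j = n - 1 all degrees that test membership in M are covered. *)
have key (M' : C) : M M' -> forall j k, (0 < k <= j)%N -> (k < n)%N ->
    @Ext_null (op C) M' k (L j).
  move=> MM'; elim=> [|j IH] k lt_k lt_kn; first by lia.
  have sop : @short_exact (op C) _ _ _ (sc (s j)) (sa (s j)) by have [] := sP (s j).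
  have nB : @Ext_null (op C) M' k (sB (s j)).
    apply: (Ext_zero_null (abelian_op Cab)).
    apply: (proj1 (@Ext_zero_op C _ _ _)); apply: ct_zero => //.
      by case: (sM j).
    by lia.
  rewrite Ls; case: k lt_k lt_kn nB => [//|[|k]] lt_k lt_kn nB.
    apply: (Ext1_null_kernel (abelian_op Cab) sop) => // f.
    by have [h fh] := proj2 (sM j) _ f MM'; exists h.
  apply: (Ext_null_kernel (abelian_op Cab) sop) => //; apply: IH; lia.
have [_ _ _ MP _] := Mct; apply/MP => M' i MM' lt_in.
apply: (proj2 (@Ext_zero_op C _ _ _)).
apply: (@Ext_null_zero (op C) M n M' (abelian_op Cab)) => //.
  by move=> M0 j MM0 lt_jn; apply: (proj1 (@Ext_zero_op C _ _ _)); apply: ct_zero.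
by apply: key => //; lia.
Qed.

(** * The n-exact sequence of approximations *)

Section Build.
Variables (X M0 Y : C) (x : hom X M0) (p : hom M0 Y).
Hypotheses (xp : short_exact x p) (MX : M X) (MM0 : M M0).

Definition cosyzygy i : C := iter i (fun K => sK (approx K)) Y.

Definition build_L (i : nat) : C := if i is j.+1 then cosyzygy j else X.

Definition build_S : nat -> C :=
  fun i => match i with 0 => X | 1 => M0 | j.+2 => sB (approx (cosyzygy j)) end.

Definition build_q i : hom (build_S i) (build_L i) :=
  match i with
  | 0 => idm X
  | 1 => p
  | j.+2 => sc (approx (cosyzygy j))
  end.

Definition build_a i : hom (build_L i) (build_S i.+1) :=
  match i with 0 => x | j.+1 => sa (approx (cosyzygy j)) end.

Definition build_seq : sequence C :=
  @Sequence C build_S (fun i => build_a i ∘ build_q i).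

(** The cosyzygy number n - 1 of Y lies in M, where the chosen approximation is an isomorphism. *)
Lemma build_last : is_iso (build_a n).
Proof.
case: n n_gt0 (@cosyzygy_in_ct cosyzygy (fun i => approx (cosyzygy i))) => [//|k] _ h.
by apply: approx_iso; apply: h => // i; apply: approxP.
Qed.

Lemma build_ses i : short_exact (build_a i) (build_q i.+1).
Proof. by case: i => [|i] //=; apply: sP. Qed.

Definition build_resolved : resolved n build_seq :=
  @Resolved C n build_seq build_L build_q build_a (fun i => erefl) (iso_id X)
    build_last (fun i _ => build_ses i).

Lemma build_in i : M (build_seq i).
Proof. by case: i => [|[|i]] //=; case: (approxP (cosyzygy i)). Qed.

(** Each step along the sequence costs one degree, starting from L 0 = X in M. Degree 1 gives the
    lifting needed for the n-kernel property. *)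
Lemma null_syzygy (U0 : C) k i : M U0 -> (0 < k)%N -> (k + i < n)%N ->
  Ext_null U0 k (build_L i).
Proof.
move=> MU0; elim: i k => [|i IH] k k_gt0 lt_n.
  by apply: ct_null => //; lia.
apply: (Ext_null_cokernel Cab (build_ses i)).
  by apply: ct_null => //; [apply: build_in|lia].
by apply: IH; lia.
Qed.

Lemma build_n_exact : n_exact n M build_seq.
Proof.
split=> [i _|M' MM'|M' MM']; first exact: build_in.
  split=> [h|i lt_in h].
    apply: epi_eq0; apply: epi_comp; first exact: (iso_epi build_last).
    exact: (rq_epi (r := build_resolved) (leqnn n)).
  rewrite (resolved_cokernel build_resolved h lt_in); split=> -[y ->].
    have [y' ->] := proj2 (approxP (cosyzygy i)) _ y MM'.
    by exists y'; rewrite -compA.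
  by exists (y ∘ sa (approx (cosyzygy i))); rewrite -compA.
split=> [h|i lt_in h].
  apply: mono_eq0; apply: mono_comp; first exact: ses_mono xp.
  exact/iso_mono/iso_id.
rewrite (resolved_kernel build_resolved h lt_in); split=> -[y ->].
  suff [h' ->] : exists h', y = build_q i ∘ h' by exists h'; rewrite /= compA.
  case: i lt_in y {h} => [|i] lt_in y; first by exists y; rewrite comp1m.
  apply: (Ext1_null_lift Cab y (build_ses i)).
  by apply: null_syzygy => //; lia.
by exists (build_q i ∘ y); rewrite /= compA.
Qed.

(* Covers the condition Ext^(n-1)(U0, Y) = 0 and the vanishing of lower Ext's
   forced by X and M0 lying in M. *)
Lemma build_hom_exact (U0 : C) : M U0 -> (forall f : hom U0 Y, f = 0%R) ->
  Ext_zero n.-1 U0 Y -> hom_exact U0 build_seq 2 n.+1.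
Proof.
move=> MU0 UY0 UY; apply/(hom_exactP build_resolved) => //.
split=> // i lt_in.
(* One degree more than [null_syzygy]: at j = 1 the extreme case k = n - 1 is exactly the hypothesis
   on Y. *)
have key j : (0 < j)%N -> forall k, (0 < k)%N -> (k + j <= n)%N ->
    Ext_null U0 k (build_L j).
  case: j => [//|j] _; elim: j => [|j IH] k k_gt0 le_n.
    have [lt_n|ge_n] := ltnP k n.-1.
      apply: (Ext_null_cokernel Cab xp); first by apply: ct_null => //; lia.
      by apply: ct_null => //; lia.
    have -> : k = n.-1 by lia.
    exact: Ext_zero_null.
  apply: (Ext_null_cokernel Cab (build_ses j.+1)).
    by apply: ct_null => //; [exact: (build_in j.+2)|lia].
  by apply: IH; lia.
case: i lt_in => [//|i] lt_in f.
apply: (Ext1_null_lift Cab f (build_ses i)); apply: key; lia.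
Qed.

End Build.

Lemma n_torsion_resolution (U : subcat C) M0 : n_torsion_class n M U -> M M0 ->
  exists (S : sequence C) (r : resolved n S),
    [/\ isomorphic (S 1) M0, U (S 0), short_exact (diff S 0) (rq r 1),
        forall i, (i <= n.+1)%N -> M (S i)
      & forall U0, U U0 -> (forall f : hom U0 (rL r 1), f = 0%R) /\
          forall i, (1 < i <= n)%N -> onto r U0 i].
Proof.
move=> [Uiso UM seqs] MM0; have [S [ex SM0 US0 hex]] := seqs _ MM0.
have [r _] := n_exact_resolved Cab gen cog n_gt0 ex.
exists S, r; split=> //; last by move=> U0 UU0; apply/hom_exactP/hex.
  rewrite (r_diff r); apply: (ses_iso_left Cab (r_fst r)).
  exact: r_ses.
by case: ex.
Qed.

(** Shifting down from L (n-1) to L 1 gives Ext^(n-i)(U0, L i) = 0; the start, Ext^1 of L (n-1), is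
    the surjectivity of Hom(U0, S n) -> Hom(U0, L n). *)
Lemma n_torsion_Ext_null (S : sequence C) (r : resolved n S) U0 :
  M U0 -> (forall i, (i <= n.+1)%N -> M (S i)) ->
  (forall i, (1 < i <= n)%N -> onto r U0 i) ->
  (1 < n)%N -> Ext_null U0 n.-1 (rL r 1).
Proof.
move=> MU0 MS surj n_gt1.
have key k i : (i + k.+1)%N = n -> (0 < i)%N -> Ext_null U0 k.+1 (rL r i).
  elim: k i => [|k IH] i ik i_gt0.
    have lt_in : (i < n)%N by lia.
    apply: (Ext1_null_kernel Cab (r_ses r lt_in)); first by apply: surj; lia.
    by apply: ct_null => //; apply: MS; lia.
  have lt_in : (i < n)%N by lia.
  apply: (Ext_null_kernel Cab (r_ses r lt_in)); first by apply: IH; lia.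
  by apply: ct_null => //; [apply: MS|]; lia.
have -> : n.-1 = n.-2.+1 by lia.
by apply: key; lia.
Qed.

End Resolutions.

(** * The correspondence and its image *)

Section Main.
Variable C : preadditive.
Hypotheses (Cab : abelian C) (Clen : length_category C).
Variables (n : nat) (M : subcat C).
Hypothesis n_gt0 : (0 < n)%N.
Hypothesis Mct : cluster_tilting n M.

Lemma torsion_sequence_iso (T F : subcat C) (X N Y N' : C) (i : hom X N)
    (p : hom N Y) (f : hom N N') : is_iso f -> torsion_sequence T F i p ->
  exists (i' : hom X N') (p' : hom N' Y), torsion_sequence T F i' p'.
Proof.
move=> [g [gf fg]] [[ip pi] TX FY]; exists (f ∘ i), (p ∘ g).
have miso : is_iso f by exists g.
have giso : is_iso g by exists f.
split=> //; apply: (mono_cokernel_ses Cab).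
  by apply: mono_comp; [apply: iso_mono|apply: kernel_mono ip].
apply: cokernelP.
- by apply: epi_comp; [apply: cokernel_epi pi|apply: iso_epi].
- by rewrite compA -(compA p) gf compm1 (proj1 ip).
move=> W h; rewrite compA => /(cokernel_desc pi)[h' hP].
by exists h'; rewrite compA -hP -compA fg compm1.
Qed.

Section Class.
Variables (U T F : subcat C).
Hypotheses (Utors : n_torsion_class n M U) (TF : torsion_pair T F).
Hypothesis TU : T ≡ torsion_closure U.

Let U_T : U ⊆ T.
Proof. by move=> X UX; apply/TU; case: (closure_least Cab Clen U) => _ h _; apply: h. Qed.

Lemma n_torsion_sequence M0 : M M0 ->
  exists (S : sequence C) (r : resolved n S) (i : hom (S 0) M0) (p : hom M0 (rL r 1)),
    [/\ torsion_sequence T F i p, U (S 0), forall j, (j <= n.+1)%N -> M (S j)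
      & forall U0, U U0 -> forall j, (1 < j <= n)%N -> onto r U0 j].
Proof.
move=> MM0.
have [S [r [[f fiso] US0 s MS hU]]] := n_torsion_resolution Cab n_gt0 Mct Utors MM0.
have ts : torsion_sequence T F (diff S 0) (rq r 1).
  split=> //; first exact: U_T.
  apply/(torsion_free_rperp Cab Clen TF TU) => X g UX.
  by have [h _] := hU _ UX; apply: h.
have [i [p ip]] := torsion_sequence_iso fiso ts.
by exists S, r, i, p; split=> // U0 /hU[].
Qed.

Lemma n_torsion_parts : U ≡ torsion_parts T F M.
Proof.
have [Uiso UM _] := Utors; have [_ _ TF0 _] := TF.
move=> X; split=> [UX|[M0 MM0 [Y [i [p ip]]]]].
  exists X; first exact: UM.
  have [Z Z0] := has_zero Cab.
  exists Z, (idm X), 0%R; split; [exact: ses_to_zero|exact: U_T|].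
  by apply/(torsion_free_rperp Cab Clen TF TU) => W f _; apply: (proj1 Z0).
have [S [r [j [q [jq US0 _ _]]]]] := n_torsion_sequence MM0.
have [XS _] := torsion_sequence_unique TF (isomorphic_refl M0) ip jq.
by apply: Uiso US0; apply: isomorphic_sym.
Qed.

Lemma n_torsion_cap : U ≡ subcat_cap T M.
Proof.
have [Uiso UM _] := Utors.
move=> X; split=> [UX|[TX MX]]; first by split; [apply: U_T|apply: UM].
apply/n_torsion_parts; exists X => //; have [Z Z0] := has_zero Cab.
exists Z, (idm X), 0%R; split=> //; first exact: ses_to_zero.
by apply/(torsion_free_rperp Cab Clen TF TU) => W f _; apply: (proj1 Z0).
Qed.

Lemma n_torsion_Ext X Y :
  torsion_parts T F M X -> torsion_cokernels T F M Y -> Ext_zero n.-1 X Y.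
Proof.
move=> /n_torsion_parts UX [M0 MM0 [X' [i [p ip]]]].
have [_ UM _] := Utors; have [_ _ TF0 _] := TF.
have [n_gt1|n_le1] := ltnP 1 n; last first.
  (* For n = 1 the condition reads Hom(T, F) = 0. *)
  have -> : n.-1 = 0 by lia.
  by move=> f; apply: TF0; [apply: U_T|case: ip].
have [S [r [j [q [jq US0 MS surj]]]]] := n_torsion_sequence MM0.
have [_ YL] := torsion_sequence_unique TF (isomorphic_refl M0) ip jq.
apply: (ct_null_zero Cab Mct); [exact: UM|lia|].
apply: (Ext_null_iso Cab (isomorphic_sym YL)).
by apply: (n_torsion_Ext_null Cab n_gt0 Mct (UM _ UX) MS (surj _ UX)) => //.
Qed.

End Class.

Lemma torsion_parts_n_torsion (T F : subcat C) : torsion_pair T F ->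
  (forall M0 X, M M0 -> is_torsion_part T F M0 X -> M X) ->
  (forall X Y, torsion_parts T F M X -> torsion_cokernels T F M Y ->
     Ext_zero n.-1 X Y) ->
  n_torsion_class n M (torsion_parts T F M).
Proof.
move=> TF tM ext; have [Tiso Fiso TF0 seqs] := TF; split.
- move=> X X' [f [g [gf fg]]] [M0 MM0 [Y [i [p [ip TX FY]]]]].
  exists M0 => //; exists Y, (i ∘ g), p; split=> //.
    by apply: (ses_iso_left Cab) => //; exists f.
  by apply: Tiso TX; exists f, g.
- by move=> X [M0 MM0 tX]; apply: tM MM0 tX.
move=> M0 MM0; have [X [Y [i [p ip]]]] := seqs M0.
have tX : is_torsion_part T F M0 X by exists Y, i, p.
have MX : M X by apply: tM MM0 tX.
case: (ip) => ips TX FY.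
exists (build_seq Cab Mct i p); split.
- exact: build_n_exact.
- exact: isomorphic_refl.
- by exists M0.
move=> U0 tU0; have [M1 MM1 t1] := tU0.
apply: build_hom_exact => //.
- exact: tM MM1 t1.
- by case: t1 => Y1 [i1 [p1 [_ TU0 _]]] f; apply: TF0.
- by apply: ext => //; exists M0 => //; exists X, i, p.
Qed.

End Main.

Theorem theorem1p1 (C : preadditive) (n : nat) (M : subcat C) :
  abelian C -> length_category C -> skeletally_small C ->
  1 <= n -> cluster_tilting n M ->
  [/\ (forall U, n_torsion_class n M U ->
         least_torsion_class U (torsion_closure U)),
      (forall U U', n_torsion_class n M U -> n_torsion_class n M U' ->
         U ⊆ U' -> torsion_closure U ⊆ torsion_closure U'),
      (forall U U', n_torsion_class n M U -> n_torsion_class n M U' ->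
         torsion_closure U ≡ torsion_closure U' -> U ≡ U')
    & forall T F, torsion_pair T F ->
        ((exists2 U, n_torsion_class n M U & T ≡ torsion_closure U) <->
         [/\ (forall M0 X, M M0 -> is_torsion_part T F M0 X -> M X),
             least_torsion_class (torsion_parts T F M) T
           & forall X Y, torsion_parts T F M X -> torsion_cokernels T F M Y ->
               Ext_zero n.-1 X Y]) /\
        (forall U, n_torsion_class n M U -> T ≡ torsion_closure U ->
           U ≡ subcat_cap T M /\ U ≡ torsion_parts T F M)].
Proof.
move=> Cab Clen _ n_gt0 Mct; split.
- by move=> U _; apply: closure_least.
- by move=> U U' _ _ UU' X UX T tT U'T; apply: UX => // Y /UU'; apply: U'T.
- move=> U U' Ut U't UU' X.
  have TF := closure_torsion_pair Cab Clen U.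
  (* Both U and U' are the torsion parts of M for the single pair (T(U), [rperp U]). *)
  have e1 := n_torsion_parts Cab Clen n_gt0 Mct Ut TF (fun Y => iff_refl _) X.
  have e2 := n_torsion_parts Cab Clen n_gt0 Mct U't TF UU' X.
  exact: iff_trans e1 (iff_sym e2).
move=> T F TF; split; last first.
  move=> U Ut TU; split; first exact: (n_torsion_cap Cab Clen n_gt0 Mct Ut TF TU).
  exact: (n_torsion_parts Cab Clen n_gt0 Mct Ut TF TU).
split=> [[U Ut TU]|[tM [tT Tparts Tmin] ext]].
  have parts := n_torsion_parts Cab Clen n_gt0 Mct Ut TF TU.
  have [_ UM _] := Ut; split.
  - by move=> M0 X MM0 tX; apply/UM/parts; exists M0.
  - split; first by exists F.
      by move=> X [M0 _ [Y [i [p []]]]].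
    move=> T' tT' T'parts X /TU UX; apply: UX => // Y /parts; exact: T'parts.
  - exact: (n_torsion_Ext Cab Clen n_gt0 Mct Ut TF TU).
(* Minimality of T over its torsion parts identifies T with the closure of this U. *)
exists (torsion_parts T F M); first exact: torsion_parts_n_torsion.
move=> X; split=> [TX T' tT' T'parts|]; first exact: Tmin TX.
exact.
Qed.
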